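(* Let $L=\mathrm{PSL}_n(p)$, where $p$ and $n$ are primes, $n>13$, and $p$ is a primitive root modulo $n$. Then the compact form $\mathcal{S}_{\mathrm{c}}(L)$ of the solvable graph of $L$ is not a split graph.
   Context: All graphs are simple and finite. A graph is split if its vertex set can be partitioned into a set inducing a complete graph (a clique) and an independent set; either set may be empty. For a finite group $G$, $\pi(G)$ denotes the set of prime divisors of $|G|$. The solvable graph $\mathcal{S}(G)$ has vertex set $\pi(G)$, and two distinct primes $r,s\in\pi(G)$ are adjacent if and only if $G$ has a solvable subgroup of order divisible by $rs$. For a vertex $a$ of a graph $\Gamma$, $a^{\bot}$ denotes the ball of radius 1 centered at $a$, i.e. the set consisting of $a$ and all vertices adjacent to $a$. The compact form $\Gamma_{\mathrm{c}}$ of $\Gamma$ is the quotient graph $\Gamma/_{\equiv}$, where $u\equiv v$ if and only if $u^{\bot}=v^{\bot}$: its vertices are the equivalence classes, and two distinct classes are adjacent if and only if their representatives are adjacent in $\Gamma$. $\mathcal{S}_{\mathrm{c}}(G)$ is the compact form of $\mathcal{S}(G)$. *)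

(* Defs.v *)
From HB Require Import structures.
From mathcomp Require Import all_boot all_order all_algebra all_fingroup all_solvable.

Set Implicit Arguments.
Unset Strict Implicit.
Unset Printing Implicit Defensive.

Import GroupScope.

Record sgraph := SGraph {
  vertex :> finType;
  adj : rel vertex;
  adj_sym : symmetric adj;
  adj_irr : irreflexive adj
}.

(* K is the clique, ~: K the independent set; either may be empty. *)
Definition split_graph (X : sgraph) : Prop :=
  exists K : {set X},
    {in K &, forall x y, x != y -> adj x y} /\
    {in ~: K &, forall x y, ~~ adj x y}.

Definition ball (X : sgraph) (x : X) : {set X} :=
  [set y | (y == x) || adj x y].

Section Compact.
Variable X : sgraph.

Definition ball_classes : {set {set X}} := preim_partition (@ball X) [set: X].

Definition compact_vertex : finType := {B : {set X} | B \in ball_classes}.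

(* By compact_adjE below, the choice of representatives is irrelevant. *)
Definition compact_adj : rel compact_vertex := fun B C =>
  (B != C) && [exists u in val B, exists v in val C, adj u v].

Lemma compact_adj_sym : symmetric compact_adj.
Proof.
suff H B C : compact_adj B C -> compact_adj C B by move=> B C; apply/idP/idP; apply: H.
case/andP=> neqBC /exists_inP[u Bu /exists_inP[v Cv uv]].
rewrite /compact_adj eq_sym neqBC; apply/exists_inP; exists v => //.
by apply/exists_inP; exists u; rewrite // adj_sym.
Qed.

Lemma compact_adj_irr : irreflexive compact_adj.
Proof. by move=> B; rewrite /compact_adj eqxx. Qed.

Definition compact : sgraph := SGraph compact_adj_sym compact_adj_irr.

Lemma mem_ball_class (B : compact) u v :
  u \in val B -> (v \in val B) = (ball u == ball v).
Proof.
case: B => B /= /imsetP[x _ ->]; rewrite !inE /= => /eqP ->.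
by [].
Qed.

Lemma compact_adjE (B C : compact) (u v : X) :
  u \in val B -> v \in val C -> B != C -> adj B C = adj u v.
Proof.
move=> Bu Cv neqBC; rewrite /= /compact_adj neqBC /=.
apply/idP/idP => [/exists_inP[x Bx /exists_inP[y Cy xy]]|uv]; last first.
  by apply/exists_inP; exists u => //; apply/exists_inP; exists v.
have disj (w : X) : w \in val B -> w \in val C -> False.
  move=> Bw Cw; case/eqP: neqBC; apply/val_inj/setP => z.
  by rewrite (mem_ball_class z Bw) (mem_ball_class z Cw).
have : y \in ball u.
  by move: Bu; rewrite (mem_ball_class u Bx) => /eqP <-; rewrite inE xy orbT.
rewrite inE => /orP[/eqP eq_yu | uy]; first by case: (disj y); rewrite // eq_yu.
have : u \in ball v.
  move: Cv; rewrite (mem_ball_class v Cy) => /eqP <-.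
  by rewrite inE adj_sym uy orbT.
rewrite inE => /orP[/eqP eq_uv | vu]; last by rewrite adj_sym.
by case: (disj u); rewrite // eq_uv.
Qed.

End Compact.

Section Solvable.
Variables (gT : finGroupType) (G : {group gT}).

(* The subtype of naturals occurring in primes #|G|, i.e. \pi(G). *)
Definition solv_vertex : finType := seq_sub (primes #|G|).

Definition solv_adj : rel solv_vertex := fun r s =>
  (r != s) &&
  [exists H : {group gT},
     [&& H \subset G, solvable H & val r * val s %| #|H|]%N].

Lemma solv_adj_sym : symmetric solv_adj.
Proof.
move=> r s; rewrite /solv_adj eq_sym; congr (_ && _).
by apply: eq_existsb => H; rewrite mulnC.
Qed.

Lemma solv_adj_irr : irreflexive solv_adj.
Proof. by move=> r; rewrite /solv_adj eqxx. Qed.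

Definition solvable_graph : sgraph := SGraph solv_adj_sym solv_adj_irr.

End Solvable.

Section PSL.
(* As in the library, 'F_p is the field of order p only for p prime, and
   {'GL_n(p)} consists of matrices of size n only for n > 0. *)
Variables n p : nat.

Definition SL : {set {'GL_n(p)}} := [set A | (\det (GLval A) == 1)%R].

Lemma SL_group_set : group_set SL.
Proof.
apply/group_setP; split=> [|A B]; rewrite !inE ?GL_1E ?det1 //.
move=> /eqP dA /eqP dB; rewrite GL_ME det_mulmx dA dB.
by rewrite GRing.Theory.mulr1.
Qed.

Canonical SL_group : {group {'GL_n(p)}} := Group SL_group_set.

Definition PSL := (SL / 'Z(SL))%G.

End PSL.

Definition primitive_root_mod (n g : nat) : Prop :=
  coprime g n /\
  forall a : nat, coprime a n -> exists k : nat, (g ^ k = a %[mod n])%N.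

(* Main.v *)
(* Write ord q for the multiplicative order of p modulo a prime q <> p.  As p is
   a primitive root, ord n = n - 1.  Zsigmondy's theorem gives primes r, a, b, c
   with ord r = n and ord a, ord b, ord c equal to odd numbers i, j, k such that
   n/2 < i < k, k + j <= n, and neither i nor j divides n - 1.  The classes of
   r, n, a, b then induce 2K_2 in the compact form.
   Edges: r - n in the normaliser of a Singer cycle, a - b and b - c in block
   diagonal tori; c separates the classes of a and b, and a prime d whose order
   is a proper divisor of n - 1 separates those of n and r.
   Non-edges: a solvable group of order divisible by q s contains, up to swapping
   q and s, a nontrivial elementary abelian q-group E normalised by an element x
   of order s.  Over the algebraic closure E has at most n weights, on which both
   x and the Frobenius act; the Frobenius orbits have length ord q on nontrivial
   weights, which forces x to centralise E, and for commuting elements it forces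
   ord q + ord s <= n or lcm (ord q) (ord s) <= n. *)

From HB Require Import structures.
Require Import Defs.
From mathcomp Require Import all_boot all_order all_algebra all_fingroup all_solvable.
From mathcomp Require Import all_field zify.

Set Implicit Arguments.
Unset Strict Implicit.
Unset Printing Implicit Defensive.

Import Order.TTheory GroupScope GRing.Theory Num.Theory VectorInternalTheory.

(** For positive x this is the multiplicative order of x modulo q, encoded so that [q %| x ^ k - 1]
    rewrites to [f %| k]. *)
Definition has_order (q x f : nat) := forall k, (q %| x ^ k - 1)%N = (f %| k)%N.

(** * Multiplicative orders modulo a prime and lifting of exponents *)

Section Arithmetic.
Local Open Scope nat_scope.

Lemma eqn_mod1_dvd q a : 0 < a -> (q %| a - 1) = (a == 1 %[mod q]).
Proof. by move=> a_gt0; rewrite eqn_mod_dvd. Qed.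

Lemma has_order_exists q x : prime q -> ~~ (q %| x) ->
  exists f, [/\ 0 < f, has_order q x f & f %| q.-1].
Proof.
move=> q_pr q'x; have x_gt0 : 0 < x by case: x q'x => //; rewrite dvdn0.
have exX k : (q %| x ^ k - 1) = (x ^ k == 1 %[mod q]).
  by rewrite eqn_mod1_dvd ?expn_gt0 ?x_gt0.
have fermat : q %| x ^ q.-1 - 1.
  by rewrite exX -totient_prime // Euler_exp_totient // coprime_sym prime_coprime.
have ex_f : exists k, (0 < k) && (q %| x ^ k - 1).
  by exists q.-1; rewrite fermat andbT; have := prime_gt1 q_pr; lia.
case: (ex_minnP ex_f) => f /andP[f_gt0 qf] min_f.
have ordf : has_order q x f.
  move=> k; have modk : x ^ k = x ^ (k %% f) %[mod q].
    rewrite {1}(divn_eq k f) expnD mulnC [(_ * f)%N]mulnC expnM -modnMmr -modnXm.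
    by move: qf; rewrite exX => /eqP->; rewrite modnXm exp1n modnMmr muln1.
  rewrite exX modk -exX /dvdn; apply/idP/idP => [qr | /eqP->]; last by rewrite mod0n.
  have := ltn_pmod k f_gt0; rewrite ltnNge; apply: contraNT; rewrite -lt0n => r_gt0.
  by rewrite min_f // r_gt0.
by exists f; rewrite -ordf.
Qed.

Section Order.
Variables q x f : nat.
Hypotheses (q_pr : prime q) (x_gt0 : 0 < x) (f_gt0 : 0 < f) (ordq : has_order q x f).

Lemma has_order_ndvd : ~~ (q %| x).
Proof.
have dv : q %| x ^ f - 1 by rewrite ordq.
apply/negP=> qx; have := dvdn_exp f_gt0 qx.
rewrite -(subnK (_ : 1 <= x ^ f)) ?expn_gt0 ?x_gt0 // dvdn_addr // dvdn1.
by have := prime_gt1 q_pr; lia.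
Qed.

Lemma has_order_dvd_pred : f %| q.-1.
Proof.
rewrite -ordq eqn_mod1_dvd ?expn_gt0 ?x_gt0 // -totient_prime //.
by rewrite Euler_exp_totient // coprime_sym prime_coprime // has_order_ndvd.
Qed.

End Order.

(** The cofactor 1 + u + ... + u^(k-1) of u - 1 is congruent to k modulo s, hence prime to s. *)
Lemma logn_sub_expn1 s u k : prime s -> s %| u - 1 -> 1 < u -> 0 < k -> ~~ (s %| k) ->
  logn s (u ^ k - 1) = logn s (u - 1).
Proof.
move=> s_pr su u_gt1 k_gt0 s'k.
have u1 : u = 1 %[mod s] by apply/eqP; rewrite -eqn_mod1_dvd // ltnW.
have sumk : \sum_(i < k) u ^ i = k %[mod s].
  transitivity ((\sum_(i < k) 1) %% s); last by rewrite sum1_card card_ord.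
  rewrite -modn_summ -[in RHS]modn_summ.
  congr (_ %% _); apply: eq_bigr => i _.
  by rewrite -modnXm u1 modnXm exp1n.
have sum_gt0 : 0 < \sum_(i < k) u ^ i.
  by case: k k_gt0 {s'k sumk} => // k _; rewrite big_ord_recl.
rewrite !subn1 predn_exp lognM //; last by rewrite -subn1 subn_gt0.
by rewrite (lognE _ (\sum_(_ < _) _)) s_pr sum_gt0 /dvdn sumk -/(dvdn s k) (negPf s'k) addn0.
Qed.

(** Writing u = 1 + st, the cofactor of u - 1 is congruent to s modulo s^2, so s divides it exactly
    once. Oddness makes the sum of the exponents, s(s-1)/2, a multiple of s. *)
Lemma logn_sub_expn_prime s u : prime s -> odd s -> s %| u - 1 -> 1 < u ->
  logn s (u ^ s - 1) = (logn s (u - 1)).+1.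
Proof.
move=> s_pr odd_s /dvdnP[t Dt] u_gt1.
have Du : u = (1 + s * t)%N by rewrite mulnC -Dt subnKC // ltnW.
have powu i : u ^ i = 1 + i * (s * t) %[mod s ^ 2].
  elim: i => [|i IHi]; first by rewrite mul0n.
  rewrite expnS -modnMmr IHi modnMmr Du.
  apply/eqP; rewrite eqn_mod_dvd; last by nia.
  by apply/dvdnP; exists (i * t * t); nia.
have sumu : \sum_(i < s) u ^ i = s %[mod s ^ 2].
  rewrite -modn_summ (eq_bigr (fun i : 'I_s => (1 + i * (s * t)) %% s ^ 2)); last first.
    by move=> i _; apply: powu.
  rewrite modn_summ big_split /= sum1_card card_ord -big_distrl /=.
  rewrite -(big_mkord xpredT id) bin2_sum bin2odd //.
  apply/eqP; rewrite -[X in _ == X %[mod _]]addn0 eqn_modDl mod0n.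
  by apply/dvdnP; exists (s.-1./2 * t); lia.
have [w Dw] : exists w, \sum_(i < s) u ^ i = (s * w)%N.
  have : s %| \sum_(i < s) u ^ i.
    have sdv: s %| s ^ 2 by rewrite expnS dvdn_mulr.
    by rewrite /dvdn -(modn_dvdm _ sdv) sumu modn_dvdm // modnn.
  by case/dvdnP=> w ->; exists w; rewrite mulnC.
have s_gt0 := prime_gt0 s_pr.
have w1 : w = 1 %[mod s].
  apply/eqP; move/eqP: sumu; rewrite Dw -[X in _ == X %[mod _]]muln1 expnS expn1.
  by rewrite -!muln_modr eqn_pmul2l.
have s'w : ~~ (s %| w) by rewrite /dvdn w1 -/(dvdn s 1) dvdn1; have := prime_gt1 s_pr; lia.
have w_gt0 : 0 < w by case: w s'w {Dw w1} => //; rewrite dvdn0.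
rewrite !subn1 predn_exp Dw !lognM ?muln_gt0 ?s_gt0 //; last by rewrite -subn1 subn_gt0.
by rewrite (logn_prime _ s_pr) eqxx (lognE _ w) (negPf s'w) !andbF addn0 addn1.
Qed.

(** * Values of cyclotomic polynomials *)

Definition cyc (m z : nat) : nat := `|('Phi_m).[z%:Z]%R|%N.

Lemma cyc_prod m z : 0 < m -> 0 < z -> \prod_(d <- divisors m) cyc d z = z ^ m - 1.
Proof.
move=> m_gt0 z_gt0; rewrite /cyc -(big_morph absz abszM (erefl : `|1%R| = 1)).
rewrite -horner_prod prod_Cyclotomic // hornerD hornerN hornerXn hornerC.
by rewrite -natz -natrX natz subzn // expn_gt0 z_gt0.
Qed.

(** Over [algC] the value is a product of [totient m] factors z - w^k with w^k of modulus 1. *)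
Lemma cyc_bounds m z : 0 < m -> 0 < z ->
  (z - 1) ^ totient m <= cyc m z <= (z + 1) ^ totient m.
Proof.
move=> m_gt0 z_gt0; have [w prim_w] := C_prim_root_exists m_gt0.
have Dcyc : ((cyc m z)%:R = \prod_(k < m | coprime k m) `|z%:R - w ^+ k| :> algC)%R.
  rewrite -normr_prod /cyc -[LHS]/((Posz `|_|%N)%:~R)%R abszE intr_norm.
  rewrite -(horner_map intr) /= (Cintr_Cyclotomic prim_w) /cyclotomic horner_prod.
  by congr `|_|%R; apply: eq_bigr => k _; rewrite !hornerE.
have Dtot : totient m = #|[pred k : 'I_m | coprime k m]|.
  rewrite totient_count_coprime big_mkord -sum1_card [RHS]big_mkcond /=.
  by apply: eq_bigr => k _; rewrite coprime_sym inE; case: coprime.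
have w1 k : (`|w ^+ k| = 1 :> algC)%R.
  apply/eqP; rewrite -(pexpr_eq1 m_gt0) ?normr_ge0 // -normrX exprAC.
  by rewrite (prim_expr_order prim_w) expr1n normr1.
rewrite -!(ler_nat algC) !natrX natrB // natrD Dcyc Dtot -!prodr_const.
apply/andP; split; apply: ler_prod => k _; rewrite ?subr_ge0 ?ler1n ?z_gt0 ?normr_ge0 /=.
  by have := lerB_dist (z%:R : algC)%R (w ^+ k)%R; rewrite w1 normr_nat.
by have := ler_normB (z%:R : algC)%R (w ^+ k)%R; rewrite w1 normr_nat.
Qed.

Lemma cyc_gt0 m z : 0 < m -> 1 < z -> 0 < cyc m z.
Proof.
move=> m_gt0 z_gt1; have /andP[le_cyc _] := cyc_bounds m_gt0 (ltnW z_gt1).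
by apply: leq_trans le_cyc; rewrite expn_gt0 subn_gt0 z_gt1.
Qed.

Lemma logn_prod_seq (I : eqType) (r : seq I) (F : I -> nat) s :
  (forall i, i \in r -> 0 < F i) ->
  logn s (\prod_(i <- r) F i) = \sum_(i <- r) logn s (F i).
Proof.
elim: r => [|i r IHr] F_gt0; first by rewrite !big_nil logn1.
rewrite !big_cons lognM ?IHr ?F_gt0 ?mem_head //.
  by move=> j rj; rewrite F_gt0 // inE rj orbT.
rewrite big_seq prodn_cond_gt0 // => j rj; by rewrite F_gt0 // inE rj orbT.
Qed.

Lemma logn_expn_sub1_cyc s m z : 0 < m -> 1 < z ->
  logn s (z ^ m - 1) = \sum_(d <- divisors m) logn s (cyc d z).
Proof.
move=> m_gt0 z_gt1; rewrite -cyc_prod ?(ltnW z_gt1) //; apply: logn_prod_seq => d.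
by rewrite -dvdn_divisors // => dm; apply: cyc_gt0 => //; apply: dvdn_gt0 dm.
Qed.

(** Uniqueness in Moebius inversion; it transfers valuations of the numbers z^d - 1 to their
    cyclotomic factors. *)
Lemma divisor_sum_inj (f g : nat -> nat) m : 0 < m ->
    (forall d, d %| m -> \sum_(e <- divisors d) f e = \sum_(e <- divisors d) g e) ->
  forall d, d %| m -> f d = g d.
Proof.
move=> m_gt0 eq_sum d; elim/ltn_ind: d => d IHd dm.
have d_gt0 : 0 < d by apply: dvdn_gt0 dm.
have d_in : d \in divisors d by apply: divisors_id.
move: (eq_sum d dm); rewrite (big_rem d) //= [X in _ = X](big_rem d) //=.
rewrite (eq_big_seq g) => [/addIn //|e].
rewrite mem_rem_uniq ?divisors_uniq // inE -dvdn_divisors // => /andP[ne ed].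
by rewrite IHd ?(dvdn_trans ed) // ltn_neqAle ne dvdn_leq.
Qed.

Lemma sum_divisors_eq C D d : 0 < d ->
  \sum_(e <- divisors d) C * (e == D) = C * (D %| d).
Proof.
move=> d_gt0; rewrite -big_distrr /= dvdn_divisors //; congr (_ * _).
rewrite -(count_uniq_mem _ (divisors_uniq d)) -sum1_count [RHS]big_mkcond /=.
by apply: eq_bigr => e _; case: eqP.
Qed.

Lemma dvdn_expn_sub1 z a b : 0 < z -> a %| b -> z ^ a - 1 %| z ^ b - 1.
Proof.
move=> z_gt0 /dvdnP[c ->]; rewrite mulnC expnM !subn1.
by rewrite [((_ ^ c).-1)]predn_exp dvdn_mulr.
Qed.

Lemma muln_succ_ltn_expn k y : 4 < k -> 1 < y -> k * (y + 1) + 1 < y ^ k.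
Proof.
move=> k_gt4 y_gt1; rewrite -(subnK k_gt4); elim: (k - 5) => [|j IHj].
  rewrite add0n; have: 2 ^ 4 * y <= y ^ 4 * y by rewrite leq_mul2r leq_exp2r // y_gt1 orbT.
  by rewrite -expnSr; lia.
by rewrite addSn expnS; move: IHj; set c := y ^ _; nia.
Qed.

Lemma ndvdn_logn A B : 0 < A -> 0 < B -> ~~ (A %| B) ->
  exists2 s, prime s & logn s B < logn s A.
Proof.
move=> A_gt0 B_gt0 ndv; have [all_le|] := boolP (all (fun s => logn s A <= logn s B) (primes A)).
  case/negP: ndv; apply/dvdn_partP => // s sA; have := sA.
  rewrite mem_primes => /andP[s_pr _]; rewrite p_part pfactor_dvdn //.
  exact: (allP all_le).
case/allPn=> s; rewrite mem_primes => /andP[s_pr _]; rewrite -ltnNge => lt_s.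
by exists s.
Qed.

Lemma dvdn_pred_prime_ltn d s : prime s -> d %| s.-1 -> d < s.
Proof.
case: s => [|[|s]] // _ dvs; exact: leq_ltn_trans (dvdn_leq _ dvs) _.
Qed.

Lemma cyc1 z : 1 < z -> cyc 1 z = z - 1.
Proof.
move=> z_gt1; have := cyc_prod (m := 1) isT (ltnW z_gt1).
by rewrite big_cons big_nil muln1 expn1.
Qed.

Lemma dvdn_cyc m z : 0 < m -> 0 < z -> cyc m z %| z ^ m - 1.
Proof.
by move=> m_gt0 z_gt0; rewrite -cyc_prod // (big_rem m) ?divisors_id //= dvdn_mulr.
Qed.

(** The size estimate behind Zsigmondy's theorem. For m > 1 an odd prime divisor of m lies below P,
    so P >= 5 and P(y + 1) < y^P - 1; the bounds on [cyc] then compare the two values. *)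
Lemma cyc_ratio_gt m y P : odd m -> prime P -> odd P ->
    (forall s, prime s -> s %| m -> s < P) -> 0 < m -> 1 < y ->
  P * cyc m y < cyc m (y ^ P).
Proof.
move=> odd_m P_pr odd_P max_P m_gt0 y_gt1.
have P_gt2 : 2 < P by have := prime_gt1 P_pr; move: odd_P; case: P {P_pr max_P} => [|[|[|]]].
have yP_gt1 : 1 < y ^ P by rewrite -{1}(exp1n P) ltn_exp2r // prime_gt0.
have [->|m_gt1] := eqVneq m 1.
  rewrite !cyc1 // [y ^ P - 1]subn1 predn_exp subn1 mulnC ltn_pmul2l; last by lia.
  rewrite -{1}(card_ord P) -sum1_card.
  have lt1P : 1 < P by lia.
  (* The summand of index 1, equal to y > 1, makes the inequality strict. *)
  rewrite (bigD1 (Ordinal lt1P)) //= [X in _ < X](bigD1 (Ordinal lt1P)) //= expn1.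
  rewrite -addSn leq_add //.
  by apply: leq_sum => i _; rewrite expn_gt0; lia.
have P_gt4 : 4 < P.
  have := max_P _ (pdiv_prime (_ : 1 < m)) (pdiv_dvd m).
  have odd_q : odd (pdiv m) by apply: dvdn_odd (pdiv_dvd m) odd_m.
  have m1 : 1 < m by lia.
  move=> /(_ m1); have := pdiv_prime m1; move: (pdiv m) odd_q => q odd_q /prime_gt1.
  by lia.
have /andP[_ leB] := cyc_bounds m_gt0 (ltnW y_gt1).
have /andP[leA _] := cyc_bounds m_gt0 (ltnW yP_gt1).
have lt_base : P * (y + 1) < y ^ P - 1 by have := muln_succ_ltn_expn P_gt4 y_gt1; lia.
have tot_gt0 : 0 < totient m by rewrite totient_gt0.
apply: leq_trans leA; apply: leq_ltn_trans (_ : (P * (y + 1)) ^ totient m < _); last first.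
  by rewrite ltn_exp2r.
rewrite expnMn leq_mul // -{1}(expn1 P) leq_pexp2l //; lia.
Qed.

(** * Primitive prime divisors *)

Section NoPrimitiveDivisor.
Variables (x P e m : nat).
Hypotheses (x_gt1 : 1 < x) (P_pr : prime P) (odd_P : odd P) (e_gt0 : 0 < e).
Hypothesis m_gt0 : 0 < m.
Hypothesis max_P : forall s, prime s -> s %| m -> s < P.
Local Notation N := (P ^ e * m).
Local Notation y := (x ^ (P ^ e.-1)).
Local Notation z := (y ^ P).

Let x_gt0 : 0 < x. Proof. exact: ltnW. Qed.
Let Dz : z = x ^ (P ^ e). Proof. by rewrite -expnM -expnSr prednK. Qed.
Let y_gt1 : 1 < y.
Proof. by rewrite -{1}(exp1n (P ^ e.-1)) ltn_exp2r // expn_gt0 prime_gt0. Qed.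
Let z_gt1 : 1 < z.
Proof. by rewrite -{1}(exp1n P) ltn_exp2r // prime_gt0. Qed.

(* cyc m z / cyc m y is the value at x of the cyclotomic polynomial of index N.  A
   prime s for which x has a smaller order occurs to the same power in cyc m z and
   cyc m y, except that s = P may occur once more in the former. *)
Lemma has_order_logn_cyc s : prime s ->
  logn s (P * cyc m y) < logn s (cyc m z) -> has_order s x N.
Proof.
move=> s_pr; have P_gt0 := prime_gt0 P_pr.
rewrite lognM ?cyc_gt0 // (logn_prime _ P_pr).
have [sA|s'A] := boolP (s %| cyc m z); last by rewrite [X in _ < X]lognE (negPf s'A) !andbF.
have s_zm : s %| z ^ m - 1 by apply: dvdn_trans sA _; rewrite dvdn_cyc // ltnW.
have s'x : ~~ (s %| x).
  apply/negP=> sx; have szm : s %| z ^ m.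
    by rewrite !Euclid_dvdX // m_gt0 P_gt0 expn_gt0 P_gt0 sx.
  have zm_gt0 : 0 < z ^ m by rewrite expn_gt0 (ltnW z_gt1).
  have : s %| 1 by move: s_zm; rewrite -{2}(subKn zm_gt0) => s_zm; rewrite dvdn_sub.
  by rewrite dvdn1 => /eqP s1; rewrite s1 in s_pr.
have [D [D_gt0 ordD D_s]] := has_order_exists s_pr s'x.
have s_z d : (s %| z ^ d - 1) = (D %| P ^ e * d) by rewrite Dz -expnM ordD.
have s_y d : (s %| y ^ d - 1) = (D %| P ^ e.-1 * d) by rewrite -expnM ordD.
have DN : D %| N by rewrite -s_z.
have [eq_DN|neq_DN] := eqVneq D N; first by move=> _ k; rewrite -eq_DN ordD.
rewrite ltnNge => /negP[].
have ltsP d : d %| m -> s %| d -> s < P by move=> dm sd; apply: max_P (dvdn_trans sd dm).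
have zd d : z ^ d = (y ^ d) ^ P by rewrite -!expnM [(P * d)]mulnC.
have logn0 w : ~~ (s %| w) -> logn s w = 0 by move=> nd; rewrite lognE (negPf nd) !andbF.
have X_gt1 w d : 1 < w -> 0 < d -> 1 < w ^ d by move=> w1 d0; rewrite -{1}(exp1n d) ltn_exp2r.
(* A gain of C in the valuation of z^d - 1 over that of y^d - 1, at exactly the multiples d of D',
   is due to the single cyclotomic factor of index D'. *)
have key C D' : (forall d, d %| m -> logn s (z ^ d - 1) = C * (D' %| d) + logn s (y ^ d - 1)) ->
    logn s (cyc m z) = C * (m == D') + logn s (cyc m y).
  move=> eq_log; apply: (@divisor_sum_inj (fun d => logn s (cyc d z))
    (fun d => C * (d == D') + logn s (cyc d y)) m) => // d dm.
  have d_gt0 := dvdn_gt0 m_gt0 dm.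
  by rewrite big_split /= -!logn_expn_sub1_cyc // sum_divisors_eq // eq_log.
have [Dsp|neq_sP] := eqVneq s P.
  (* D divides P - 1, so it is prime to P, and lifting the exponent applies with gain 1 at the
     multiples of D. *)
  subst s; rewrite (key 1 D) ?mul1n ?leq_add2r ?leq_b1 // => d dm.
  have d_gt0 := dvdn_gt0 m_gt0 dm.
  have co_DP k : coprime D (P ^ k).
    apply: coprimeXr; rewrite coprime_sym prime_coprime //; apply/negP=> PD.
    by have := dvdn_pred_prime_ltn P_pr (dvdn_trans PD D_s); rewrite ltnn.
  have [Dd|D'd] := boolP (D %| d).
    by rewrite zd logn_sub_expn_prime ?s_y ?dvdn_mull ?X_gt1 ?expn_gt0 ?P_gt0.
  by rewrite !logn0 // ?s_y ?s_z Gauss_dvdr.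
rewrite /= add0n.
have [PeD|Pe'D] := boolP (P ^ e %| D).
  (* P divides s - 1, so s exceeds P and does not divide m. For d dividing m, the valuation of z^d -
     1 is then constant on the multiples of D' and zero elsewhere, so it is carried by the index D',
     which is not m. *)
  have [D' def_D] := dvdnP PeD.
  have s_gtP : P < s.
    have PD : P %| s.-1 by apply: dvdn_trans D_s; apply: dvdn_trans PeD; apply: dvdn_exp.
    exact: dvdn_pred_prime_ltn PD.
  have s'm : ~~ (s %| m) by apply/negP => /(ltsP m (dvdnn m)); rewrite ltnNge ltnW.
  have PX_gt0 : 0 < P ^ e by rewrite expn_gt0 P_gt0.
  have s_zD' d : (s %| z ^ d - 1) = (D' %| d) by rewrite s_z def_D mulnC dvdn_pmul2l.
  have neq_mD' : m != D'.
    by apply: contra neq_DN => /eqP mD'; rewrite mD' mulnC -def_D.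
  have D'_gt0 : 0 < D' by move: D_gt0; rewrite def_D muln_gt0 => /andP[].
  suffices -> : logn s (cyc m z) = 0 by [].
  have -> : 0 = logn s (z ^ D' - 1) * (m == D') by rewrite (negPf neq_mD') muln0.
  apply: (@divisor_sum_inj (fun d => logn s (cyc d z))
    (fun d => logn s (z ^ D' - 1) * (d == D')) m) => // d dm.
  have d_gt0 := dvdn_gt0 m_gt0 dm.
  rewrite -logn_expn_sub1_cyc // sum_divisors_eq //.
  have [/dvdnP[k Dk]|D'd] := boolP (D' %| d); last by rewrite muln0 logn0 // s_zD'.
  have zD'_gt1 : 1 < z ^ D' by apply: X_gt1.
  have k_gt0 : 0 < k by move: d_gt0; rewrite Dk muln_gt0 => /andP[].
  rewrite muln1 Dk mulnC expnM logn_sub_expn1 ?s_zD' //.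
  by apply: contra s'm => sk; rewrite (dvdn_trans _ dm) // Dk dvdn_mulr.
(* When P^e does not divide D, s divides z^d - 1 only if it divides y^d - 1, and raising to the
   power P, prime to s, gains nothing. *)
rewrite (key 0 0) ?mul0n ?add0n // => d dm; rewrite mul0n add0n.
have d_gt0 := dvdn_gt0 m_gt0 dm.
have [sz|s'z] := boolP (s %| z ^ d - 1); last first.
  rewrite !logn0 //; apply: contra s'z => sy; apply: dvdn_trans sy _.
  by rewrite zd -{1}(expn1 (y ^ d)) dvdn_expn_sub1 // ltnW // X_gt1.
have yd_gt1 : 1 < y ^ d by apply: X_gt1.
have s'P : ~~ (s %| P) by rewrite dvdn_prime2.
rewrite zd logn_sub_expn1 ?s_y //.
move: sz; rewrite s_z => DPd.
have [D' co_D' def_D] := pfactor_coprime P_pr D_gt0.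
have log_lt : logn P D < e.
  rewrite ltnNge; apply: contra Pe'D => le_e.
  by rewrite def_D dvdn_mull // dvdn_exp2l.
rewrite def_D mulnC dvdn_mul //.
  by rewrite dvdn_exp2l // -ltnS prednK.
have : D' %| P ^ e * d by apply: dvdn_trans DPd; rewrite def_D dvdn_mulr.
by rewrite Gauss_dvdr // coprime_sym coprimeXl.
Qed.

End NoPrimitiveDivisor.

(** Let P be the largest prime divisor of N and N = P^e m. By size, [cyc m (y ^ P)] cannot divide
    [P * cyc m y]; a prime with larger valuation in the former has order N. *)
Lemma zsigmondy_odd x N : 1 < x -> odd N -> 1 < N ->
  exists2 s, prime s & has_order s x N.
Proof.
move=> x_gt1 odd_N N_gt1; have N_gt0 := ltnW N_gt1.
pose P := max_pdiv N; have P_pr : prime P := max_pdiv_prime N_gt1.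
have PN : P %| N := max_pdiv_dvd N.
have odd_P : odd P := dvdn_odd PN odd_N.
have [m co_Pm def_N] := pfactor_coprime P_pr N_gt0.
set e := logn P N in def_N.
have e_gt0 : 0 < e by rewrite logn_gt0 mem_primes P_pr N_gt0 PN.
have m_gt0 : 0 < m by move: N_gt0; rewrite def_N muln_gt0 => /andP[].
have mN : m %| N by rewrite def_N dvdn_mulr.
have max_P s : prime s -> s %| m -> s < P.
  move=> s_pr sm; rewrite ltn_neqAle max_pdiv_max ?andbT; last first.
    by rewrite mem_primes s_pr N_gt0 (dvdn_trans sm).
  apply: contraTneq sm => ->; by rewrite -prime_coprime.
pose y := x ^ (P ^ e.-1).
have y_gt1 : 1 < y by rewrite -{1}(exp1n (P ^ e.-1)) ltn_exp2r // expn_gt0 prime_gt0.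
have ltBA := cyc_ratio_gt (dvdn_odd mN odd_N) P_pr odd_P max_P m_gt0 y_gt1.
have yP_gt1 : 1 < y ^ P by rewrite -{1}(exp1n P) ltn_exp2r // prime_gt0.
have A_gt0 := cyc_gt0 m_gt0 yP_gt1.
have B_gt0 : 0 < P * cyc m y by rewrite muln_gt0 prime_gt0 // cyc_gt0.
have ndv : ~~ (cyc m (y ^ P) %| P * cyc m y).
  by apply: contraL ltBA => /(dvdn_leq B_gt0); rewrite -leqNgt.
have [s s_pr lt_s] := ndvdn_logn A_gt0 B_gt0 ndv.
exists s => //; rewrite def_N mulnC.
exact: (has_order_logn_cyc x_gt1 P_pr odd_P e_gt0 m_gt0 max_P s_pr lt_s).
Qed.

(** * Orders 4 and n - 1, and the numerical choice of i, j, k and t *)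

Lemma has_order_uniq q x f g : has_order q x f -> has_order q x g -> f = g.
Proof.
by move=> ordf ordg; apply/eqP; rewrite eqn_dvd -ordf ordg dvdnn -ordg ordf dvdnn.
Qed.

Lemma has_order_pred_odd q x f : prime q -> 0 < x -> 1 < f -> odd f -> has_order q x f ->
  odd q /\ 2 * f < q.
Proof.
move=> q_pr x_gt0 f_gt1 odd_f ordq; have f_gt0 := ltnW f_gt1.
have fq := has_order_dvd_pred q_pr x_gt0 f_gt0 ordq.
have odd_q : odd q.
  case: (even_prime q_pr) => // q2; move: fq; rewrite q2 dvdn1 => /eqP f1.
  by rewrite f1 in f_gt1.
split=> //; apply: dvdn_pred_prime_ltn q_pr _; rewrite Gauss_dvd ?coprime2n // fq andbT dvdn2.
by case: q odd_q {ordq fq}.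
Qed.

(** Since 4 does not divide x^2 + 1, that number has an odd prime divisor s; modulo s the square of
    x is -1, which differs from 1. *)
Lemma has_order4_exists x : 1 < x -> exists2 s, prime s & has_order s x 4.
Proof.
move=> x_gt1.
have [w odd_w [w_gt1 dvw]] : exists2 w, odd w & 1 < w /\ w %| x ^ 2 + 1.
  have Dx := odd_double_half x; set h := x./2 in Dx; case: (odd x) Dx => Dx.
    exists (2 * (h * h) + 2 * h + 1); first by lia.
    by split; [nia | apply/dvdnP; exists 2; nia].
  by exists (x ^ 2 + 1); [nia | split; [nia | done]].
have s_pr := pdiv_prime w_gt1; set s := pdiv w in s_pr.
have sx : s %| x ^ 2 + 1 by apply: dvdn_trans dvw; apply: pdiv_dvd.
have odd_s : odd s by apply: dvdn_odd odd_w; apply: pdiv_dvd.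
have s'2 : ~~ (s %| 2).
  by apply/negP=> s2; move: odd_s; rewrite (eqP (_ : s == 2)) -?dvdn_prime2.
have s'x : ~~ (s %| x).
  apply/negP=> sdx; move: sx; rewrite dvdn_addr ?dvdn_exp // dvdn1 => /eqP s1.
  by rewrite s1 in s_pr.
have [D [D_gt0 ordD _]] := has_order_exists s_pr s'x.
exists s => //; suffices <- : D = 4 by [].
have D4 : D %| 4.
  rewrite -ordD (_ : x ^ 4 - 1 = (x ^ 2 - 1) * (x ^ 2 + 1)) ?dvdn_mull //.
  by rewrite -[4]/(2 * 2) expnM -[1 in LHS](exp1n 2) subn_sqr ?exp1n.
have D'2 : ~~ (D %| 2).
  rewrite -ordD; apply: contra s'2 => sx2.
  have -> : 2 = x ^ 2 + 1 - (x ^ 2 - 1).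
    have : 0 < x ^ 2 by rewrite expn_gt0 ltnW.
    by move: (x ^ 2) => y; clear; lia.
  exact: dvdn_sub.
have := dvdn_leq (isT : 0 < 4) D4; move: D D4 D'2 {ordD D_gt0}.
by case=> [|[|[|[|[|]]]]].
Qed.

(** Every nonzero residue is a power of p with exponent below f, which injects n - 1 residues into f
    exponents. *)
Lemma primitive_root_has_order n p : prime n -> primitive_root_mod n p -> has_order n p n.-1.
Proof.
move=> n_pr [co_pn root_p].
have n'p : ~~ (n %| p) by rewrite -prime_coprime // coprime_sym.
have [f [f_gt0 ordf f_n]] := has_order_exists n_pr n'p.
suffices -> : n.-1 = f by [].
have n_gt1 := prime_gt1 n_pr.
have p_gt0 : 0 < p by case: p n'p {co_pn root_p ordf} => //; rewrite dvdn0.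
have p_f : p ^ f = 1 %[mod n] by apply/eqP; rewrite -eqn_mod1_dvd ?expn_gt0 ?p_gt0 // ordf.
apply/eqP; rewrite eqn_leq [f <= _]dvdn_leq ?andbT //; last by rewrite -subn1 subn_gt0.
have /fin_all_exists[u Du] (i : 'I_n.-1) : exists u : 'I_f, p ^ u = i.+1 %[mod n].
  have lt_in : i.+1 < n by rewrite -[n in _ < n](ltn_predK n_gt1) ltnS.
  have [|k Dk] := root_p i.+1.
    by rewrite coprime_sym prime_coprime // gtnNdvd.
  exists (Ordinal (ltn_pmod k f_gt0)); rewrite -Dk /= {2}(divn_eq k f) expnD.
  have p_fX a : p ^ (a * f) = 1 %[mod n] by rewrite mulnC expnM -modnXm p_f modnXm exp1n.
  by rewrite -modnMml p_fX modnMml mul1n.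
have inj_u : injective u.
  move=> i j eq_u; apply: val_inj; have := Du j; rewrite -eq_u Du.
  by rewrite !modn_small ?ltnS => [[]||]; rewrite // -[n in _ < n](ltn_predK n_gt1) ltnS.
by have := leq_card u inj_u; rewrite !card_ord.
Qed.

(** n < 2i and i < k will exclude the edge a - c, j + k <= n leaves room for block diagonal tori,
    and the last two conditions keep j from dividing n - 1. The witnesses are the least odd i > n/2,
    the least odd j > (n - 1)/4, and k = i + 2. *)
Lemma order_choice n : odd n -> 13 < n -> prime n -> exists i j k,
  [/\ odd i, odd j & odd k] /\
  [/\ n < 2 * i, i < k, j + k <= n, n.-1 < 4 * j & 2 * j != n.-1].
Proof.
move=> odd_n n_gt13 n_pr.
(* At n = 15 the witnesses would give j + k = 16. *)
have n15 : n != 15 by apply: contraTneq n_pr => ->.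
have [h Dh] : exists h, n = 2 * h + 1 by exists (n./2); lia.
exists (2 * ((h + 1) %/ 2) + 1), (2 * ((h %/ 2 + 1) %/ 2) + 1), (2 * ((h + 1) %/ 2) + 3).
by split; split; lia.
Qed.

Lemma ltn_lcmn n f : 0 < n -> 0 < f -> ~~ (f %| n) -> n < lcmn n f.
Proof.
move=> n_gt0 f_gt0 f'n; rewrite ltn_neqAle dvdn_leq ?lcmn_gt0 ?n_gt0 ?dvdn_lcml ?andbT //.
by apply: contra f'n => /eqP def_n; rewrite def_n dvdn_lcmr.
Qed.

Lemma leq_double_lcmn n f : 0 < n -> 0 < f -> ~~ (f %| n) -> 2 * n <= lcmn n f.
Proof.
move=> n_gt0 f_gt0 f'n; have := ltn_lcmn n_gt0 f_gt0 f'n.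
case/dvdnP: (dvdn_lcml n f) => w ->; rewrite -{1}(mul1n n) ltn_pmul2r // => w_gt1.
by rewrite leq_mul2r w_gt1 orbT.
Qed.

(** The least prime factor of m/2 is either odd or 2, and in the latter case 4 divides m. Both kinds
    of t are orders of p modulo some prime. *)
Lemma odd_divisor_or_four m : 13 < m -> ~~ odd m ->
  exists t, [/\ 1 < t, t %| m, t != m & odd t \/ t = 4].
Proof.
move=> m_gt13 even_m; have [h Dm] : exists h, m = 2 * h by exists m./2; lia.
have h_gt1 : 1 < h by lia.
have t_pr := pdiv_prime h_gt1; have th := pdiv_dvd h.
case: (even_prime t_pr) => [t2|odd_t].
  exists 4; split; [done| |lia|by right].
  by rewrite Dm (_ : 4 = 2 * 2) // dvdn_pmul2l // -t2.
exists (pdiv h); split; [exact: prime_gt1|by rewrite Dm dvdn_mull| |by left].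
by apply: contraNneq even_m => <-.
Qed.

Lemma odd_ndvd_even_half m b : ~~ odd m -> odd b -> 0 < m -> m < 2 * b -> ~~ (b %| m).
Proof.
move=> even_m odd_b m_gt0 lt_m; apply/negP=> /dvdnP[w Dw].
by case: w Dw => [|[|w]] Dw; [lia | lia | nia].
Qed.

(** The quotient would be even, positive and less than 4, hence 2. *)
Lemma odd_ndvd_even_quarter m j :
  ~~ odd m -> odd j -> 0 < m -> m < 4 * j -> 2 * j != m -> ~~ (j %| m).
Proof.
move=> even_m odd_j m_gt0 lt_m ne; apply/negP=> /dvdnP[w Dw].
by case: w Dw => [|[|[|[|w]]]] Dw; [lia | lia | lia | lia | nia].
Qed.

End Arithmetic.

(** * Weights of a matrix group over an algebraically closed field *)

Section Weights.
Local Open Scope ring_scope.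

Variables (p m : nat) (p_pr : prime p).
Variables (K : closedFieldType) (phi : {rmorphism 'F_p -> K}).
Local Notation n := m.+1.
Variables (gT : finGroupType) (rho : gT -> 'M['F_p]_m.+1).
Hypotheses (rho1 : rho 1%g = 1%:M) (rhoM : {morph rho : x y / (x * y)%g >-> x *m y}).
Hypothesis rho_inj : injective rho.
Local Notation lift g := (map_mx phi (rho g)).
Implicit Types (E : {group gT}) (w : gT -> K).

(** The simultaneous eigenvalues of E on a common row eigenvector; only the values of w on E
    matter. *)
Definition weight (E : {set gT}) (w : gT -> K) : Prop :=
  exists2 v : 'rV[K]_n, v != 0 & {in E, forall e, v *m lift e = w e *: v}.

Lemma liftM (g h : gT) : lift (g * h)%g = lift g *m lift h.
Proof. by rewrite -map_mxM -rhoM. Qed.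

Lemma lift1 : lift 1%g = 1%:M.
Proof. by rewrite rho1 map_mx1. Qed.

Lemma liftX (g : gT) k : lift (g ^+ k)%g = lift g ^+ k.
Proof.
by elim: k => [|k IHk]; rewrite ?lift1 // expgS exprS liftM IHk.
Qed.

Lemma weight1 E w : weight E w -> w 1%g = 1.
Proof.
case=> v nzv /(_ 1%g (group1 E)); rewrite lift1 mulmx1 => def_v.
apply/eqP; rewrite -subr_eq0; move/eqP: def_v; rewrite -{1}[v]scale1r eq_sym.
by rewrite -subr_eq0 -scalerBl scaler_eq0 (negPf nzv) orbF.
Qed.

Lemma weightM E w : weight E w -> {in E &, {morph w : x y / (x * y)%g >-> x * y}}.
Proof.
case=> v nzv vE x y Ex Ey; apply/eqP; rewrite -subr_eq0.
have /eqP := vE _ (groupM Ex Ey).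
rewrite liftM mulmxA vE // -scalemxAl vE // scalerA eq_sym -subr_eq0.
by rewrite -scalerBl scaler_eq0 (negPf nzv) orbF.
Qed.

Lemma weightX E w e k : weight E w -> e \in E -> w (e ^+ k)%g = w e ^+ k.
Proof.
move=> wE Ee; elim: k => [|k IHk]; first by rewrite (weight1 wE).
by rewrite expgS exprS (weightM wE) ?groupX // IHk.
Qed.

Lemma pchar_lift : p \in [pchar K].
Proof. by rewrite (rmorph_pchar phi) ?pchar_Fp. Qed.

(* Apply the Frobenius of K to the entries of an eigenvector. *)
Lemma weight_frob E w k : weight E w -> weight E (fun e => w e ^+ (p ^ k)).
Proof.
elim: k => [|k IHk] /= in w *.
  by case=> v nzv vE; exists v => // e Ee; rewrite expr1 vE.
move/IHk=> [v nzv vE]; exists (map_mx (pFrobenius_aut pchar_lift) v).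
  by rewrite map_mx_eq0.
move=> e Ee; have /(congr1 (map_mx (pFrobenius_aut pchar_lift))) := vE e Ee.
rewrite map_mxZ map_mxM /= pFrobenius_autE expnSr exprM => <-; congr (_ *m _).
apply/matrixP=> i j; rewrite !mxE pFrobenius_autE -rmorphXn /=; congr (phi _).
by have := expf_card (rho e i j); rewrite card_Fp.
Qed.

(** The eigenvector is moved to [v *m lift x^-1]. *)
Lemma weight_conj E w x :
  x \in 'N(E)%g -> weight E w -> weight E (fun e => w (e ^ x)%g).
Proof.
move=> nEx [v nzv vE]; exists (v *m lift x^-1%g).
  apply: contraNneq nzv => /(congr1 (mulmx^~ (lift x))).
  by rewrite -mulmxA -liftM mulVg lift1 mulmx1 mul0mx => ->.
move=> e Ee; rewrite -mulmxA -liftM.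
have ->: (x^-1 * e = e ^ x * x^-1)%g by rewrite conjgE -!mulgA mulgV mulg1.
by rewrite liftM mulmxA vE ?memJ_norm // -scalemxAl.
Qed.

Section Diagonal.
Variable E : {group gT}.
Hypotheses (cEE : abelian E) (p'E : coprime p #|E|).

(** The matrix is annihilated by X^|E| - 1, which is separable because p does not divide |E|. *)
Lemma diagonalizable_lift e : e \in E -> diagonalizable (lift e).
Proof.
move=> Ee; apply/diagonalizableP.
have [rs Drs] := closed_field_poly_normal ('X^#|E| - 1 : {poly K}).
have nzE: (#|E|%:R : K) != 0.
  by rewrite -(dvdn_pcharf pchar_lift) -prime_coprime.
exists rs.
  rewrite -separable_prod_XsubC.
  by move: Drs; rewrite (monicP (monicXnsubC _ _)) ?scale1r // => <-; apply: separable_Xn_sub_1.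
move: Drs; rewrite (monicP (monicXnsubC _ _)) ?scale1r // => <-.
rewrite mxminpoly_min // rmorphB rmorph1 /= rmorphXn /= horner_mx_X.
by rewrite -liftX expg_cardG // lift1 subrr.
Qed.

Lemma weight_basis : exists2 P : 'M[K]_n, P \in unitmx &
  exists d : gT -> 'rV[K]_n, {in E, forall e, P *m lift e = diag_mx (d e) *m P}.
Proof.
have [|P uP /allP dP] := (codiagonalizableP [seq lift e | e in E]).1.
  split=> [A B|A] /imageP[x Ex ->]; last exact: diagonalizable_lift.
  case/imageP=> y Ey ->; rewrite /comm_mx -!liftM.
  by rewrite (centsP cEE x Ex y Ey).
exists P => //; exists (fun e => \row_j (conjmx P (lift e)) j j) => e Ee.
have /diag_mxP[D /eqP dE] := dP (lift e) (image_f (fun e => lift e) Ee).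
have /(simmxP uP) -> : lift e ~_P (diag_mx D) by [].
congr (diag_mx _ *m _); apply/rowP=> j.
by rewrite mxE (eqP dE) mxE eqxx mulr1n.
Qed.

(** In a basis of common eigenvectors, any nonzero coordinate of an eigenvector identifies its
    weight with one of the n diagonal ones. *)
Lemma weight_pigeonhole (I : finType) (f : I -> gT -> K) :
    (forall i, weight E (f i)) -> (n < #|I|)%N ->
  exists i j, i != j /\ {in E, f i =1 f j}.
Proof.
move=> wf ltnI; have [P uP [d Dd]] := weight_basis.
have /fin_all_exists[h hP] i : exists j, forall e, e \in E -> f i e = d e 0 j.
  have [v nzv vE] := wf i.
  have [u Dv]: exists u, v = u *m P by exists (v *m invmx P); rewrite mulmxKV.
  have [j nzuj]: exists j, u 0 j != 0.
    apply/rV0Pn; apply: contraNneq nzv => u0.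
    by rewrite Dv u0 mul0mx.
  exists j => e Ee; have /(congr1 (mulmx^~ (invmx P))) := vE e Ee.
  rewrite Dv -mulmxA Dd // mulmxA scalemxAl !mulmxK //.
  by move=> /rowP/(_ j); rewrite mul_mx_diag !mxE [RHS]mulrC => /(mulfI nzuj)->.
have /injectivePn[i [j neq_ij eq_h]]: ~~ injectiveb h.
  apply: contraL ltnI => /injectiveP inj_h; rewrite -leqNgt.
  by have := leq_card h inj_h; rewrite card_ord.
by exists i, j; split=> // e Ee; rewrite !hP // eq_h.
Qed.

(** If all diagonal weights were 1 at e, then e would act trivially, against faithfulness. Otherwise
    a row of P has the wanted weight. *)
Lemma weight_nontriv e : e \in E -> e != 1%g -> exists2 w, weight E w & w e != 1.
Proof.
move=> Ee nte; have [P uP [d Dd]] := weight_basis.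
have [all1|] := boolP [forall j, d e 0 j == 1].
  case/eqP: nte; apply: rho_inj; apply: (map_mx_inj (f := phi)).
  rewrite lift1; have /(congr1 (mulmx (invmx P))) := Dd e Ee; rewrite mulKmx //= => ->.
  have ->: d e = const_mx 1 by apply/rowP=> j; rewrite mxE (eqP (forallP all1 j)).
  by rewrite diag_const_mx mul1mx mulVmx.
rewrite negb_forall => /existsP[j dj]; exists (fun g => d g 0 j) => //.
exists (row j P) => [|g Eg].
  apply: contraTneq uP => Pj0; rewrite -row_free_unit -kermx_eq0.
  apply/negP=> /eqP kP0.
  have: (delta_mx 0 j : 'rV[K]_n) *m P = 0 by rewrite -rowE.
  move/sub_kermxP; rewrite kP0 submx0 => /eqP/matrixP/(_ 0 j)/eqP.
  by rewrite !mxE !eqxx oner_eq0.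
by rewrite -row_mul Dd // row_mul row_diag_mx -scalemxAl -rowE.
Qed.

Lemma weight_eq x y : x \in E -> y \in E ->
  (forall w, weight E w -> w x = w y) -> x = y.
Proof.
move=> Ex Ey eqw; apply/eqP; rewrite eq_mulgV1; apply/negPn/negP.
case/weight_nontriv=> [|w wE]; first by rewrite groupM ?groupV.
rewrite (weightM wE) ?groupV // eqw // -(weightM wE) ?groupV // mulgV.
by rewrite (weight1 wE) eqxx.
Qed.

End Diagonal.

Lemma expr_pchar_eq1 (a : K) k : a ^+ (p ^ k) = 1 -> a = 1.
Proof.
elim: k => [|k IHk]; first by rewrite expr1.
rewrite expnSr exprM -(pFrobenius_autE pchar_lift) => /eqP.
by rewrite fmorph_eq1 => /eqP.
Qed.

(** w(e) is a primitive q-th root of unity, so the equality says that p^k and p^l agree modulo q. *)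
Lemma weight_frob_period E w q f e k l : prime q -> q != p -> has_order q p f ->
    weight E w -> e \in E -> (e ^+ q)%g = 1%g -> w e != 1 ->
  (w e ^+ (p ^ k) == w e ^+ (p ^ l)) = (k == l %[mod f])%N.
Proof.
move=> q_pr neq_qp ordq wE Ee eq1 nt.
wlog le_lk: k l / (l <= k)%N.
  by move=> IH; case: (leqP l k) => [|/ltnW] /IH // eq_lk; rewrite eq_sym [RHS]eq_sym.
have prim_e: q.-primitive_root (w e).
  have: (w e) ^+ q = 1 by rewrite -(weightX _ wE) // eq1 (weight1 wE).
  case/prim_order_exists=> [|d prim_d]; first exact: prime_gt0.
  have /primeP[_ /[apply]/orP[]/eqP d_eq] := q_pr; last by rewrite -d_eq.
  by move: prim_d nt; rewrite d_eq => /prim_expr_order; rewrite expr1 => ->; rewrite eqxx.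
rewrite (eq_prim_root_expr prim_e) !eqn_mod_dvd ?leq_pexp2l ?prime_gt0 //.
rewrite -ordq -[in LHS](subnKC le_lk) expnD -[X in (_ - X)%N]muln1 -mulnBr.
by rewrite Gauss_dvdr // coprimeXr // prime_coprime // dvdn_prime2.
Qed.

(** * Automorphisms induced on elementary abelian subgroups, and commuting elements *)

Section Abelem.
Variables (E : {group gT}) (q f : nat).
Hypotheses (q_pr : prime q) (neq_qp : q != p) (abelE : q.-abelem E).
Hypothesis ordq : has_order q p f.

Let cEE : abelian E. Proof. by case/(abelemP q_pr): abelE. Qed.
Let expE e : e \in E -> (e ^+ q)%g = 1%g.
Proof. by case/(abelemP q_pr): abelE => _; apply. Qed.

Let p'E : coprime p #|E|.
Proof.
have /card_pgroup-> := abelem_pgroup abelE.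
by rewrite coprimeXr // prime_coprime // dvdn_prime2 // eq_sym.
Qed.

(* The Frobenius orbits of two nontrivial weights have f elements each, so they
   meet; hence x acts on every weight as a power of the Frobenius. *)
Lemma normalizer_expn_order_cent x : (n < 2 * f)%N -> x \in 'N(E)%g ->
  (x ^+ f)%g \in 'C(E)%g.
Proof.
move=> ltn2f nEx; apply/centP=> e Ee.
suffices: (e ^ (x ^+ f) = e)%g by rewrite conjgE => eq_e; rewrite /commute -{1}eq_e mulKVg.
have nExX u : (x ^+ u)%g \in 'N(E)%g by rewrite groupX.
apply: (weight_eq cEE p'E) => [||w wE] //; first by rewrite memJ_norm.
have [triv|[e0 Ee0 nt0]] : {in E, w =1 fun=> 1} \/ exists2 e0, e0 \in E & w e0 != 1.
  case: (boolP [forall e0 in E, w e0 == 1]) => [/forall_inP all1 | ].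
    by left=> e0 /all1/eqP.
  by case/forall_inPn=> e0 Ee0 nt0; right; exists e0.
- by rewrite !triv ?memJ_norm.
have [k frobk]: exists k, {in E, forall g, w (g ^ x)%g = w g ^+ (p ^ k)}.
  have ord_inj w' g (k l : 'I_f) : weight E w' -> g \in E -> w' g != 1 ->
    w' g ^+ (p ^ k) = w' g ^+ (p ^ l) -> k = l.
  - move=> w'E Eg ntg /eqP; rewrite (weight_frob_period _ _ q_pr neq_qp ordq w'E) ?expE //.
    by rewrite !modn_small // => /eqP/val_inj.
  (* The 2f Frobenius conjugates of w and of its translate by x outnumber the n weights. Within one
     summand they are distinct, so a conjugate of w is a conjugate of the translate. *)
  pose F (i : 'I_f + 'I_f) := match i with
    | inl k => fun g => w g ^+ (p ^ k)
    | inr k => fun g => w (g ^ x)%g ^+ (p ^ k) end.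
  have wF i : weight E (F i).
    by case: i => k; apply: weight_frob => //; apply: weight_conj.
  have wxE : weight E (fun g => w (g ^ x)%g) by apply: weight_conj.
  have Ee0x : (e0 ^ x^-1)%g \in E by rewrite memJ_norm ?groupV.
  have inlr k l : {in E, F (inl k) =1 F (inr l)} ->
      {in E, forall g, w (g ^ x)%g = w g ^+ (p ^ (k + (f - l)))}.
    (* A further Frobenius power of exponent f - l turns the right-hand side into the power p^f,
       which fixes the weight. *)
    move=> eqF g Eg; rewrite expnD exprM [_ ^+ (p ^ k)](eqF g Eg) /=.
    rewrite -exprM -expnD subnKC ?(ltnW (ltn_ord l)) //.
    have [->|ntg] := eqVneq (w (g ^ x)%g) 1; first by rewrite expr1n.
    rewrite -[LHS]expr1; apply/eqP; rewrite -{1}(expn0 p).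
    by rewrite (weight_frob_period _ _ q_pr neq_qp ordq wxE) ?expE // mod0n modnn.
  have [|i [j []]] := weight_pigeonhole cEE p'E wF.
    by rewrite card_sum card_ord addnn -mul2n.
  case: i j => k [] l neq eqF.
  - case/eqP: neq; congr inl; exact: ord_inj wE Ee0 nt0 (eqF _ Ee0).
  - by exists (k + (f - l))%N; apply: inlr.
  - by exists (l + (f - k))%N; apply: inlr => g Eg; rewrite eqF.
  case/eqP: neq; congr inr; apply: ord_inj wxE Ee0x _ (eqF _ Ee0x).
  by rewrite -conjgM mulVg conjg1.
have frobX u g : g \in E -> w (g ^ (x ^+ u))%g = w g ^+ (p ^ (k * u)).
  move=> Eg; elim: u => [|u IHu]; first by rewrite conjg1 muln0 expr1.
  by rewrite expgSr conjgM frobk ?memJ_norm // IHu -exprM -expnD mulnS addnC.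
(* x^f acts on w as Frobenius to the power kf, and exponents count only modulo f. *)
rewrite frobX //; have [->|nt] := eqVneq (w e) 1; first by rewrite expr1n.
rewrite -[RHS]expr1; apply/eqP; rewrite -(expn0 p).
by rewrite (weight_frob_period _ _ q_pr neq_qp ordq wE) ?expE // mod0n modnMl.
Qed.

(* A weight moved by x has an orbit of l elements, so l = n and the orbit is the
   set of all weights; the Frobenius then acts as a power of x, so f divides n. *)
Lemma normalizer_prime_cent x l : prime l -> (n <= l)%N -> ~~ (f %| n)%N ->
  (x ^+ l)%g = 1%g -> x \in 'N(E)%g -> x \in 'C(E)%g.
Proof.
move=> l_pr lenl f'n xl nEx; apply/centP=> e Ee.
suffices: (e ^ x = e)%g by rewrite conjgE => eq_e; rewrite /commute -{1}eq_e mulKVg.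
have nExX u : (x ^+ u)%g \in 'N(E)%g by rewrite groupX.
apply: (weight_eq cEE p'E) => [||w wE] //; first by rewrite memJ_norm.
apply/eqP/negPn/negP=> neq_wx.
have wxE u : weight E (fun g => w (g ^ (x ^+ u))%g) by apply: weight_conj.
(* As l is prime, some power of x^(v - u) is x, so w would be fixed by x. *)
have no_fix u v : (u < v < l)%N ->
    ~ {in E, forall g, w (g ^ (x ^+ u))%g = w (g ^ (x ^+ v))%g}.
  case/andP=> ltuv ltvl fix_uv.
  have fix_d g : g \in E -> w (g ^ (x ^+ (v - u)))%g = w g.
    move=> Eg; have := fix_uv (g ^ (x ^- u))%g.
    rewrite -!conjgM mulVg conjg1 => ->; last by rewrite memJ_norm ?groupV.
    by rewrite -{2}(subnKC (ltnW ltuv)) expgD mulKg.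
  have fix_dk k g : g \in E -> w (g ^ (x ^+ ((v - u) * k)))%g = w g.
    elim: k g => [|k IHk] g Eg; first by rewrite muln0 conjg1.
    by rewrite mulnS expgD conjgM IHk ?fix_d ?memJ_norm.
  have co_l : coprime (v - u) l.
    rewrite coprime_sym prime_coprime //; apply: contraL ltvl => /dvdn_leq.
    by rewrite subn_gt0 ltuv -leqNgt => /(_ isT)/leq_trans-> //; apply: leq_subr.
  case/eqP: neq_wx; rewrite -(fix_dk (egcdn (v - u) l).1 e Ee).
  have /(egcdnP l)[a b Dab _ /=] : (0 < v - u)%N by rewrite subn_gt0.
  by rewrite [(_ * a)%N]mulnC Dab (eqP co_l) expgD [(b * l)%N]mulnC expgM xl expg1n mul1g.
have neq_uv (u v : 'I_l) : u != v ->
    ~ {in E, forall g, w (g ^ (x ^+ u))%g = w (g ^ (x ^+ v))%g}.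
  rewrite neq_ltn => /orP[lt_uv|lt_vu] eq_uv.
    by apply: (@no_fix u v) => //; rewrite lt_uv ltn_ord.
  by apply: (@no_fix v u) => [|g Eg]; rewrite ?eq_uv // lt_vu ltn_ord.
have lln : (l <= n)%N.
  rewrite leqNgt; apply/negP => ltnl.
  have [|u [v [ne eqF]]] := weight_pigeonhole cEE p'E (I := 'I_l) wxE.
    by rewrite card_ord.
  exact: neq_uv ne eqF.
have eq_ln : l = n by apply/eqP; rewrite eqn_leq lln.
(* With its Frobenius image added, the l = n translates of w make n + 1 weights, so this image is a
   translate. *)
pose F (i : option 'I_l) := if i is Some u then fun g => w (g ^ (x ^+ u))%g
                            else fun g => w g ^+ (p ^ 1).
have wF i : weight E (F i) by case: i => [u|]; [apply: wxE | apply: weight_frob].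
have [u frobu]: exists u, {in E, forall g, w g ^+ (p ^ 1) = w (g ^ (x ^+ u))%g}.
  have [|i [j []]] := weight_pigeonhole cEE p'E wF.
    by rewrite card_option card_ord eq_ln.
  case: i j => [u|] [v|] // ne eqF.
  - by case: (@neq_uv u v).
  - by exists u => g Eg; apply/esym/(eqF g Eg).
  by exists v => g Eg; apply: (eqF g Eg).
have frobX k g : g \in E -> w g ^+ (p ^ k) = w (g ^ (x ^+ (u * k)))%g.
  elim: k g => [|k IHk] g Eg; first by rewrite muln0 conjg1 expr1.
  by rewrite expnSr exprM IHk // -(expn1 p) frobu ?memJ_norm // mulnSr expgD conjgM.
have [e0 Ee0 nt0] : exists2 e0, e0 \in E & w e0 != 1.
  have [nt|nt] := eqVneq (w e) 1; last by exists e.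
  by exists (e ^ x)%g; rewrite ?memJ_norm // -nt.
(* Since x^n = 1, the n-th Frobenius power fixes w(e0), which means that f divides n. *)
case/negP: f'n; have: w e0 ^+ (p ^ n) == w e0 ^+ (p ^ 0).
  by rewrite frobX // -eq_ln mulnC expgM xl expg1n conjg1 expr1.
by rewrite (weight_frob_period _ _ q_pr neq_qp ordq wE) ?expE // mod0n /dvdn.
Qed.

End Abelem.

(* A weight nontrivial at both x and y has lcm f g Frobenius conjugates.  Without
   such a weight, those nontrivial at x and those nontrivial at y are disjoint. *)
Lemma commuting_orders_leq q s f g (x y : gT) :
    prime q -> prime s -> q != p -> s != p -> q != s ->
    has_order q p f -> has_order s p g -> commute x y ->
    x != 1%g -> y != 1%g -> (x ^+ q)%g = 1%g -> (y ^+ s)%g = 1%g ->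
  (f + g <= n)%N || (lcmn f g <= n)%N.
Proof.
move=> q_pr s_pr neq_qp neq_sp neq_qs ordq ords cxy ntx nty xq ys.
pose E : {group gT} := <<[set x; y]>>%G.
have Ex : x \in E by rewrite mem_gen // !inE eqxx.
have Ey : y \in E by rewrite mem_gen // !inE eqxx orbT.
have cEE : abelian E.
  rewrite abelian_gen; apply/centsP=> a /set2P[]-> b /set2P[]-> //.
have p'E : coprime p #|E|.
  have ox : #[x]%g = q by apply: nt_prime_order.
  have oy : #[y]%g = s by apply: nt_prime_order.
  have -> : E :=: (<[x]> <*> <[y]>)%g by rewrite /= joing_idl joing_idr.
  rewrite norm_joinEl; last by rewrite cycle_subG (subsetP (cent_sub _)) // cent_cycle; apply/cent1P.
  rewrite TI_cardMg; last by rewrite coprime_TIg // -!orderE ox oy prime_coprime // dvdn_prime2.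
  by rewrite -!orderE ox oy coprimeMr !prime_coprime // !dvdn_prime2 // ![p == _]eq_sym neq_qp.
have inj_x w k l : weight E w -> w x != 1 -> w x ^+ (p ^ k) = w x ^+ (p ^ l) -> k = l %[mod f].
  by move=> wE nt /eqP; rewrite (weight_frob_period _ _ q_pr neq_qp ordq wE) // => /eqP.
have inj_y w k l : weight E w -> w y != 1 -> w y ^+ (p ^ k) = w y ^+ (p ^ l) -> k = l %[mod g].
  by move=> wE nt /eqP; rewrite (weight_frob_period _ _ s_pr neq_sp ords wE) // => /eqP.
have both w : weight E w -> w x != 1 -> w y != 1 -> (lcmn f g <= n)%N.
  move=> wE ntwx ntwy; rewrite leqNgt; apply/negP=> ltn.
  have wF (k : 'I_(lcmn f g)) : weight E (fun a => w a ^+ (p ^ k)) by apply: weight_frob.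
  have [|k [l [/eqP ne eqF]]] := weight_pigeonhole cEE p'E wF; first by rewrite card_ord.
  case: ne; apply: val_inj; have := inj_x w k l wE ntwx (eqF x Ex).
  have := inj_y w k l wE ntwy (eqF y Ey).
  wlog le_lk : k l {eqF} / (l <= k)%N.
    by move=> IH ey ex; case: (leqP l k) => [|/ltnW] le; [|symmetry]; apply: IH.
  move=> /eqP ey /eqP ex; apply/eqP; move: ex ey; rewrite !eqn_mod_dvd // => ex ey.
  have: (lcmn f g %| k - l)%N by rewrite dvdn_lcm ex ey.
  rewrite eqn_leq le_lk andbT -subn_eq0; apply: contraTT; rewrite -lt0n => gt0.
  by rewrite gtnNdvd // (leq_ltn_trans (leq_subr _ _)).
have [w1 w1E nt1] := weight_nontriv cEE p'E Ex ntx.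
have [w2 w2E nt2] := weight_nontriv cEE p'E Ey nty.
have [w1y|/(both _ w1E nt1)->] := eqVneq (w1 y) 1; last by rewrite orbT.
have [w2x|nt] := eqVneq (w2 x) 1; last by rewrite (both _ w2E nt nt2) orbT.
rewrite leqNgt; have [lt_fg|//] := ltnP; exfalso.
(* Conjugates of w1 are nontrivial at x and those of w2 trivial there, so the f + g functions are
   distinct. *)
pose F (i : 'I_f + 'I_g) := match i with
    | inl k => fun a => w1 a ^+ (p ^ k)
    | inr k => fun a => w2 a ^+ (p ^ k) end.
have wF i : weight E (F i) by case: i => k; apply: weight_frob.
have [|i [j []]] := weight_pigeonhole cEE p'E wF; first by rewrite card_sum !card_ord.
have inlr k l : ~ {in E, F (inl k) =1 F (inr l)}.
  move=> /(_ x Ex) /=; rewrite w2x expr1n => /expr_pchar_eq1/eqP.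
  by rewrite (negPf nt1).
case: i j => k [] l ne eqF.
- case/eqP: ne; congr inl; apply: val_inj.
  by have := inj_x w1 k l w1E nt1 (eqF x Ex); rewrite !modn_small.
- exact: inlr eqF.
- by apply: (inlr l k) => a Ea; rewrite eqF.
case/eqP: ne; congr inr; apply: val_inj.
by have := inj_y w2 k l w2E nt2 (eqF y Ey); rewrite !modn_small.
Qed.

End Weights.

(** * Solvable subgroups of order divisible by two primes: excluding edges *)

Definition joined (gT : finGroupType) (G : {set gT}) (q s : nat) : Prop :=
  exists H : {group gT}, [/\ H \subset G, solvable H & q * s %| #|H|]%N.

Lemma joinedC (gT : finGroupType) (G : {set gT}) q s : joined G q s -> joined G s q.
Proof. by case=> H [sHG solH dvH]; exists H; rewrite mulnC. Qed.

(** In a Hall subgroup for q and s, a minimal normal subgroup is elementary abelian for one of the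
    primes; Cauchy's theorem supplies x for the other. *)
Lemma solvable_two_primes (gT : finGroupType) (G : {set gT}) q s :
    prime q -> prime s -> q != s -> joined G q s ->
  exists (t u : nat) (E : {group gT}) (x : gT),
    [/\ (t, u) \in [:: (q, s); (s, q)], t.-abelem E, E :!=: 1, x \in 'N(E) & #[x] = u].
Proof.
move=> q_pr s_pr neq_qs [H [_ solH dvH]].
have [M hallM] := Hall_exists (pred2 q s) solH.
have [sMH piM pi'M] := and3P hallM; have solM := solvableS sMH solH.
have dvM (u : nat) : u \in pred2 q s -> (u %| #|M|)%N.
  move=> pi_u; have u_pr : prime u by case/pred2P: pi_u => ->.
  have pi_nat : (pred2 q s).-nat u by rewrite pnatE.
  rewrite (card_Hall hallM) -(part_pnat_id pi_nat) partn_dvd ?cardG_gt0 //.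
  by apply: dvdn_trans dvH; case/pred2P: pi_u => ->; [apply: dvdn_mulr | apply: dvdn_mull].
have ntM : M :!=: 1.
  by rewrite -cardG_gt1 (leq_trans (prime_gt1 q_pr)) // dvdn_leq ?cardG_gt0 ?dvM // inE eqxx.
have [E [sEM nsEM ntE /is_abelemP[t t_pr abelE]]] := solvable_norm_abelem solM (normal_refl M) ntM.
have : t \in pred2 q s.
  apply: (pnatPpi (pgroupS sEM piM)); rewrite mem_primes t_pr cardG_gt0 /=.
  by have [] := pgroup_pdiv (abelem_pgroup abelE) ntE.
have nEM x : x \in M -> x \in 'N(E) by apply/subsetP/normal_norm.
case/pred2P=> def_t.
  have [|x Mx ox] := Cauchy s_pr (dvM s _); first by rewrite inE eqxx orbT.
  by exists q, s, E, x; split; rewrite ?mem_head -?def_t //; apply: nEM.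
have [|x Mx ox] := Cauchy q_pr (dvM q _); first by rewrite inE eqxx.
by exists s, q, E, x; split; rewrite -?def_t ?mem_seq2 ?eqxx ?orbT //; apply: nEM.
Qed.

(* Under this condition an element of order s normalising an elementary abelian
   q-group of n x n matrices centralises it, where f is the order of p mod q. *)
Definition rigid (n f s : nat) :=
  ((n < 2 * f) && ~~ (s %| f) || (n <= s) && ~~ (f %| n))%N.

(** Whichever prime E belongs to, rigidity makes x centralise E, and [commuting_orders_leq]
    contradicts the last two bounds. *)
Lemma not_joined p m q s f g : prime p ->
    prime q -> prime s -> q != p -> s != p -> q != s ->
    has_order q p f -> has_order s p g -> rigid m.+1 f s -> rigid m.+1 g q ->
    (m.+1 < f + g)%N -> (m.+1 < lcmn f g)%N ->
  ~ joined [set: {'GL_m.+1(p)}] q s.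
Proof.
move=> p_pr q_pr s_pr neq_qp neq_sp neq_qs ordq ords rig_f rig_g lt_fg lt_lcm.
have [K [phi _]] := countable_algebraic_closure 'F_p.
pose rho := @GLval m.+1 'F_p.
have rho1 : (rho 1%g = 1%:M)%R by [].
have rhoM : {morph rho : x y / x * y >-> (x *m y)%R} by [].
have rho_inj : injective rho by apply: val_inj.
(* Forgetting the definition of rho keeps unification from unfolding GL. *)
move: rho1 rhoM rho_inj; move: rho => rho rho1 rhoM rho_inj.
have key t u h k : prime t -> prime u -> t != p -> u != p -> t != u ->
    has_order t p h -> has_order u p k ->
    rigid m.+1 h u -> (m.+1 < h + k)%N -> (m.+1 < lcmn h k)%N ->
    forall (E : {group {'GL_m.+1(p)}}) x,
      t.-abelem E -> E :!=: 1 -> x \in 'N(E) -> #[x] = u -> False.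
  move=> t_pr u_pr neq_tp neq_up neq_tu ordt ordu rig lt_hk lt_l E x abelE ntE nEx ox.
  have cEx : x \in 'C(E).
    case/orP: rig => /andP[lt_n ndv].
      have cxf := normalizer_expn_order_cent p_pr phi rho1 rhoM rho_inj t_pr neq_tp
        abelE ordt lt_n nEx.
      (* h is prime to the order of x, so x^h generates the same cyclic group as x. *)
      have := generator_coprime x h; rewrite ox prime_coprime // ndv => /eqP def_x.
      by rewrite -cycle_subG def_x cycle_subG.
    apply: (normalizer_prime_cent p_pr phi rho1 rhoM rho_inj t_pr neq_tp abelE ordt u_pr) => //.
    by rewrite -ox expg_order.
  have [e Ee nte] : exists2 e, e \in E & e != 1 by apply/trivgPn.
  have cex : commute x e by apply: (centP cEx).
  have ntx : x != 1 by rewrite -order_gt1 ox prime_gt1.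
  have xu : x ^+ u = 1 by rewrite -ox expg_order.
  have et : e ^+ t = 1 by have [_ ->] := abelemP t_pr abelE.
  have := commuting_orders_leq p_pr phi rho1 rhoM rho_inj t_pr u_pr neq_tp neq_up
    neq_tu ordt ordu (commute_sym cex) nte ntx et xu.
  by rewrite leqNgt lt_hk leqNgt lt_l.
case/(solvable_two_primes q_pr s_pr neq_qs)=> t [u [E [x []]]].
rewrite mem_seq2 => /orP[]/eqP[-> ->]; first by apply: (key q s f g).
by apply: (key s q g f) => //; rewrite 1?eq_sym // 1?addnC 1?lcmnC.
Qed.

(** * Constructing edges: field multiplications, Frobenius and block matrices *)

Section Ring.
Local Open Scope ring_scope.

(* M is multiplication by the elements of F and Phi the Frobenius of F, as
   matrices over the prime field. *)
Lemma singer_frobenius p m : prime p ->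
  exists (F : finFieldType) (M : F -> 'M['F_p]_m.+1) (Phi : 'M['F_p]_m.+1),
    [/\ #|F| = (p ^ m.+1)%N, M 1 = 1%:M, {morph M : x y / x * y >-> x *m y},
        injective M & Phi ^+ m.+1 = 1 /\ forall x, M x *m Phi = Phi *m M (x ^+ p)].
Proof.
move=> p_pr; have [F charF cardF] := pPrimePowerField p_pr (ltn0Sn m).
exists F.
(* The matrices arise in dimension [dim V], equal to m + 1 only by a proof. As this is not visibly a
   successor, the power of Phi is written as an iterate. *)
suffices [d Dd [M [Phi [M1 MM Minj PhiX comm]]]] :
    exists2 d, d = m.+1 & exists (M : F -> 'M['F_p]_d) (Phi : 'M['F_p]_d),
    [/\ M 1 = 1%:M, {morph M : x y / x * y >-> x *m y}, injective M,
      iter m.+1 (mulmx Phi) 1%:M = 1%:M & forall x, M x *m Phi = Phi *m M (x ^+ p)].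
  subst d; exists M, Phi; split=> //; split=> //; rewrite -[RHS]PhiX.
  have iterX k : iter k (mulmx Phi) 1%:M = Phi ^+ k.
    by elim: k => // k IHk; rewrite exprS iterS IHk.
  by rewrite iterX.
pose V := pPrimeCharType charF.
exists (dim V).
  rewrite -dimvf pprimeChar_dimf; have -> : #|pPrimeCharType charF| = #|F| by [].
  by rewrite cardF pfactorK.
have charV : p \in [pchar V] := charF.
have expV (v : V) : v ^+ #|F| = v := expf_card (v : F).
have Fp_frob (a : 'F_p) : a ^+ p = a.
  by have := expf_card a; rewrite card_Fp.
pose mulf (x : F) (v : 'rV['F_p]_(dim V)) := v2r ((r2v v : V) * (x : V)).
have mulf_lin x : linear (mulf x).
  by move=> a u v; rewrite /mulf linearP mulrDl -scalerAl linearP.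
pose frob (v : 'rV['F_p]_(dim V)) := v2r ((r2v v : V) ^+ p : V).
have frob_lin : linear frob.
  move=> a u v; rewrite /frob linearP -(pFrobenius_autE charV) rmorphD /=.
  by rewrite !pFrobenius_autE exprZn Fp_frob linearP.
pose mulfL x : {linear 'rV['F_p]_(dim V) -> 'rV['F_p]_(dim V)} := HB.pack (mulf x)
  (GRing.isLinear.Build _ _ _ _ _ (mulf_lin x)).
pose frobL : {linear 'rV['F_p]_(dim V) -> 'rV['F_p]_(dim V)} := HB.pack frob
  (GRing.isLinear.Build _ _ _ _ _ frob_lin).
exists (fun x => lin1_mx (mulf x)), (lin1_mx frob).
have ME x u : u *m lin1_mx (mulf x) = mulf x u := mul_rV_lin1 (mulfL x) u.
have PhiE u : u *m lin1_mx frob = frob u := mul_rV_lin1 frobL u.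
have eq_row (A B : 'M['F_p]_(dim V)) : (forall u : 'rV_(dim V), u *m A = u *m B) -> A = B.
  by move=> eqAB; apply/row_matrixP=> i; rewrite !rowE.
split.
- by apply: eq_row => u; rewrite ME /mulf mulr1 r2vK mulmx1.
- by move=> x y; apply: eq_row => u; rewrite mulmxA !ME /mulf v2rK mulrA.
- move=> x y /(congr1 (mulmx (v2r (1 : V)))); rewrite !ME /mulf v2rK !mul1r.
  by move/(can_inj v2rK).
- have iterE k (u : 'rV_(dim V)) :
      u *m iter k (mulmx (lin1_mx frob)) 1%:M = v2r ((r2v u : V) ^+ (p ^ k)).
    elim: k u => [|k IHk] u; first by rewrite mulmx1 expr1 r2vK.
    by rewrite iterS mulmxA PhiE IHk /frob v2rK -exprM -expnS.
  apply: eq_row => u; rewrite iterE mulmx1 -cardF.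
  by rewrite expV r2vK.
by move=> x; apply: eq_row => u; rewrite !mulmxA !(ME, PhiE) /mulf /frob !v2rK exprMn.
Qed.

End Ring.

Lemma joined_semidirect (gT : finGroupType) (G : {group gT}) q s (x y : gT) :
    prime q -> prime s -> q != s -> x \in G -> y \in G -> #[x] = q -> #[y] = s ->
  y \in 'N(<[x]>) -> joined G q s.
Proof.
move=> q_pr s_pr neq_qs Gx Gy ox oy nxy; exists (<[x]> <*> <[y]>)%G; split.
- by rewrite join_subG !cycle_subG Gx.
- have nyx : <[y]> \subset 'N(<[x]>) by rewrite cycle_subG.
  rewrite (series_sol (_ : <[x]> <| <[x]> <*> <[y]>)) /=; last first.
    by rewrite /normal joing_subl join_subG normG.
  by rewrite quotientYidl // !(abelian_sol, quotient_abelian, cycle_abelian).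
rewrite Gauss_dvd; last by rewrite prime_coprime // dvdn_prime2.
by rewrite -ox -oy !orderE !cardSg ?joing_subl ?joing_subr.
Qed.

(** The determinant is a root of unity of exponents s and p - 1, which are coprime. This places
    elements of order s in SL. *)
Lemma det_prime_order p k s (A : 'M['F_p]_k.+1) : prime p -> prime s -> ~~ (s %| p.-1)%N ->
  (A ^+ s = 1 -> \det A = 1)%R.
Proof.
move=> p_pr s_pr ndv As; pose d := (\det A)%R.
have detX j : (\det (A ^+ j) = \det A ^+ j)%R.
  by elim: j => [|j IHj]; rewrite ?det1 // !exprS -IHj det_mulmx.
have ds : (d ^+ s = 1)%R by rewrite /d -detX As det1.
have nz_d : (d != 0)%R.
  by apply/eqP=> d0; move/eqP: ds; rewrite d0 expr0n eqn0Ngt prime_gt0 // eq_sym oner_eq0.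
have dp : (d ^+ p.-1 = 1)%R.
  apply: (mulfI nz_d); rewrite mulr1 -exprS prednK ?prime_gt0 //.
  by have := expf_card d; rewrite card_Fp.
have [j prim_j j_s] := prim_order_exists (prime_gt0 s_pr) ds.
have j_p : (j %| p.-1)%N by rewrite (prim_order_dvd prim_j) dp.
have /primeP[_ /(_ j j_s)/orP[]/eqP j_eq] := s_pr; last by rewrite -j_eq j_p in ndv.
by have /eqP := prim_expr_order prim_j; rewrite j_eq expr1 => /eqP.
Qed.

(** Block diagonal matrices, packaged so that n need only be provably equal to i + l. *)
Lemma block_embed (R : pzRingType) i l n : n = (i + l)%N ->
  exists f : 'M[R]_i -> 'M[R]_l -> 'M[R]_n,
    [/\ f 1%:M 1%:M = 1%:M,
        forall A B C D, f (A *m C) (B *m D) = f A B *m f C D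
      & forall A B, f A B = 1%:M -> A = 1%:M /\ B = 1%:M]%R.
Proof.
move=> ->; exists (fun A B => block_mx A 0 0 B); split=> [|A B C D|A B].
- by rewrite -scalar_mx_block.
- by rewrite mulmx_block !mulmx0 !mul0mx !addr0 !add0r.
by rewrite [RHS]scalar_mx_block => /eq_block_mx[-> _ _ ->].
Qed.

Lemma GL_lift m p (A : 'M['F_p]_m.+1) k : (A ^+ k.+1 = 1)%R ->
  exists g : {'GL_m.+1(p)}, GLval g = A.
Proof.
move=> Ak; have uA : A \is a GRing.unit.
  by apply/unitrP; exists (A ^+ k)%R; rewrite -exprS -exprSr.
by exists (FinRing.unit 'M['F_p]_m.+1 uA).
Qed.

Lemma GL_expE m p (g : {'GL_m.+1(p)}) k : GLval (g ^+ k) = (GLval g ^+ k)%R.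
Proof. by elim: k => // k IHk; rewrite expgS exprS GL_ME IHk. Qed.

(** The last equation says that B normalises the group generated by A; k = 1 serves for tori and k =
    p for the Frobenius. *)
Lemma joined_mx p m q s k (A B : 'M['F_p]_m.+1) : prime p ->
    prime q -> prime s -> q != s -> ~~ (q %| p.-1)%N -> ~~ (s %| p.-1)%N ->
    (A ^+ q = 1 /\ A <> 1)%R -> (B ^+ s = 1 /\ B <> 1)%R -> (A *m B = B *m A ^+ k)%R ->
  joined (SL m.+1 p) q s.
Proof.
move=> p_pr q_pr s_pr neq_qs q'p s'p [Aq A1] [Bs B1] AB.
have [x Dx] : exists g : {'GL_m.+1(p)}, GLval g = A.
  by apply: (@GL_lift _ _ _ q.-1); rewrite prednK ?prime_gt0.
have [y Dy] : exists g : {'GL_m.+1(p)}, GLval g = B.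
  by apply: (@GL_lift _ _ _ s.-1); rewrite prednK ?prime_gt0.
have order_of (g : {'GL_m.+1(p)}) t :
    prime t -> (GLval g ^+ t = 1)%R -> (GLval g <> 1)%R -> #[g] = t.
  move=> t_pr gt g1; apply: nt_prime_order => //; first by apply: val_inj; rewrite /= GL_expE.
  by apply/eqP => g_1; apply: g1; rewrite g_1.
have ox : #[x] = q by apply: order_of; rewrite ?Dx.
have oy : #[y] = s by apply: order_of; rewrite ?Dy.
have SLx : x \in SL_group m.+1 p.
  by rewrite inE Dx (det_prime_order p_pr q_pr).
have SLy : y \in SL_group m.+1 p.
  by rewrite inE Dy (det_prime_order p_pr s_pr).
apply: (joined_semidirect q_pr s_pr neq_qs SLx SLy ox oy).
have xy : x * y = y * x ^+ k.
  apply: val_inj; change (GLval (x * y) = GLval (y * x ^+ k)).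
  by rewrite !GL_MxE GL_expE Dx Dy.
have Jx : x ^ y \in <[x]> by rewrite conjgE xy mulKg mem_cycle.
by rewrite -cycle_subG norms_cycle.
Qed.

(** The order of GL has the factor p^f - 1, so Cauchy's theorem applies. *)
Lemma mx_order_exists p m q f : prime p -> prime q -> (0 < f <= m.+1)%N -> has_order q p f ->
  exists A : 'M['F_p]_m.+1, (A ^+ q = 1 /\ A <> 1)%R.
Proof.
move=> p_pr q_pr /andP[f_gt0 le_f] ordq.
have q_GL : (q %| #|[set: {'GL_m.+1(p)}]|)%N.
  rewrite card_GL // card_Fp // dvdn_mull // (big_rem f) /=; last first.
    by rewrite mem_index_iota f_gt0.
  by rewrite dvdn_mulr // ordq.
have [g _ og] := Cauchy q_pr q_GL.
exists (GLval g); split; first by rewrite -GL_expE -og expg_order.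
by move=> g1; have := prime_gt1 q_pr; rewrite -og order_gt1 => /eqP[]; apply: val_inj.
Qed.

Lemma finField_order_exists (F : finFieldType) n q : #|F| = n -> prime q ->
  (q %| n - 1)%N -> exists x : F, (x ^+ q = 1 /\ x <> 1)%R.
Proof.
move=> <- q_pr; rewrite subn1 -card_finField_unit => q_F.
have [u _ ou] := Cauchy q_pr q_F.
exists (val u); split; first by rewrite -FinRing.val_unitX -ou expg_order.
by move=> u1; have := prime_gt1 q_pr; rewrite -ou order_gt1 => /eqP[]; apply: val_inj.
Qed.

Section Joined.
Variables (p m : nat) (p_pr : prime p).
Local Notation joinedSL := (joined (SL m.+1 p)).

Lemma joined_blocks q s f g : prime q -> prime s -> q != s ->
    ~~ (q %| p.-1)%N -> ~~ (s %| p.-1)%N -> (0 < f)%N -> (0 < g)%N ->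
    has_order q p f -> has_order s p g -> (f + g <= m.+1)%N ->
  joinedSL q s.
Proof.
move=> q_pr s_pr neq_qs q'p s'p f_gt0 g_gt0 ordq ords le_fg.
have [A [Aq A1]] : exists A : 'M['F_p]_f.-1.+1, (A ^+ q = 1 /\ A <> 1)%R.
  by apply: mx_order_exists ordq => //; lia.
have [B [Bs B1]] : exists A : 'M['F_p]_((m - f).+1), (A ^+ s = 1 /\ A <> 1)%R.
  by apply: mx_order_exists ords => //; lia.
have Dm : m.+1 = (f.-1.+1 + (m - f).+1)%N by clear -f_gt0 g_gt0 le_fg; lia.
have [h [h1 hM hI]] := block_embed 'F_p Dm.
have hX k C D : (h (C ^+ k) (D ^+ k) = h C D ^+ k)%R.
  by elim: k => [|k IHk]; rewrite ?h1 // !exprS hM IHk.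
apply: (@joined_mx p m q s 1 (h A 1) (h 1 B))%R => //.
- split; first by rewrite -hX Aq expr1n h1.
  by case/hI.
- split; first by rewrite -hX Bs expr1n h1.
  by case/hI.
by rewrite expr1 -!hM !mulmx1 !mul1mx.
Qed.

(** Both elements lie in the multiplicative group of the field of order p^k, acting on a block of
    size k. *)
Lemma joined_singer k q s : prime q -> prime s -> q != s ->
    ~~ (q %| p.-1)%N -> ~~ (s %| p.-1)%N -> (0 < k <= m.+1)%N ->
    (q %| p ^ k - 1)%N -> (s %| p ^ k - 1)%N ->
  joinedSL q s.
Proof.
move=> q_pr s_pr neq_qs q'p s'p /andP[]; case: k => // k _ le_k qk sk.
have [F [M [Phi [cardF M1 MM Minj _]]]] := singer_frobenius k p_pr.
have Dm : m.+1 = (k.+1 + (m - k))%N by rewrite addSn subnKC.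
have [h [h1 hM hI]] := block_embed 'F_p Dm.
have hX j C D : (h (C ^+ j) (D ^+ j) = h C D ^+ j)%R.
  by elim: j => [|j IHj]; rewrite ?h1 // !exprS hM IHj.
have MX j x : (M (x ^+ j) = M x ^+ j)%R.
  by elim: j => [|j IHj]; rewrite ?M1 // !exprS MM IHj.
have elt t : prime t -> (t %| p ^ k.+1 - 1)%N -> exists x : F, (x ^+ t = 1 /\ x <> 1)%R.
  exact: finField_order_exists cardF.
have [x [xq x1]] := elt q q_pr qk; have [y [ys y1]] := elt s s_pr sk.
have ntM z : (z <> 1 -> h (M z) 1 <> 1)%R.
  by move=> nz /hI[/esym]; rewrite -M1 => /Minj/esym.
apply: (@joined_mx p m q s 1 (h (M x) 1) (h (M y) 1))%R => //.
- by split; [rewrite -hX -MX xq M1 expr1n h1 | apply: ntM].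
- by split; [rewrite -hX -MX ys M1 expr1n h1 | apply: ntM].
by rewrite expr1 -!hM -!MM mulrC.
Qed.

Lemma joined_frobenius q s : prime q -> prime s -> q != s ->
    ~~ (q %| p.-1)%N -> ~~ (s %| p.-1)%N -> m.+1 = s -> (q %| p ^ s - 1)%N ->
  joinedSL q s.
Proof.
move=> q_pr s_pr neq_qs q'p s'p def_s qs.
have [F [M [Phi [cardF M1 MM Minj [PhiX comm]]]]] := singer_frobenius m p_pr.
have MX j x : (M (x ^+ j) = M x ^+ j)%R.
  by elim: j => [|j IHj]; rewrite ?M1 // !exprS MM IHj.
have [x [xq x1]] : exists x : F, (x ^+ q = 1 /\ x <> 1)%R.
  by apply: finField_order_exists q_pr _; first exact: cardF; rewrite def_s.
apply: (@joined_mx p m q s p (M x) Phi) => //.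
- by split; [rewrite -MX xq M1 | rewrite -[1%R]M1 => /Minj].
- split; first by rewrite -def_s.
  (* A trivial Frobenius would give x^p = x, so q would divide p - 1. *)
  move=> Phi1; have := comm x; rewrite Phi1 mulmx1 mul1mx => /Minj xp.
  case: x1; have nz_x : (x != 0)%R.
    by apply/eqP=> x0; move/eqP: xq; rewrite x0 expr0n eqn0Ngt prime_gt0 // eq_sym oner_eq0.
  have [j prim_j j_q] := prim_order_exists (prime_gt0 q_pr) xq.
  have j_p : (j %| p.-1)%N.
    rewrite (prim_order_dvd prim_j); apply/eqP/(mulfI nz_x).
    by rewrite mulr1 -exprS prednK ?prime_gt0.
  have /primeP[_ /(_ j j_q)/orP[]/eqP j_eq] := q_pr; last by rewrite -j_eq j_p in q'p.
  by have := prim_expr_order prim_j; rewrite j_eq expr1.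
by rewrite -MX; apply: comm.
Qed.

End Joined.

(** * From edges and non-edges to the compact form *)

Section Graph.
Local Open Scope nat_scope.

(** The clique would contain an end of each of the edges R - N and A - B, but no end of one is
    adjacent to an end of the other. The vertices d and c show that R differs from N and A from
    B. *)
Lemma compact_not_split (X : sgraph) (r n a b c d : X) :
    adj r n -> adj n d -> adj a b -> adj b c -> d \notin ball r -> c \notin ball a ->
    a \notin ball r -> b \notin ball r -> a \notin ball n -> b \notin ball n ->
  ~ split_graph (compact X).
Proof.
move=> rn nd ab bc ndr nca nar nbr nan nbn.
have cls (x : X) : exists B : compact X, x \in val B.
  have cx : [set y in [set: X] | ball x == ball y] \in ball_classes X by apply: imset_f.
  by exists (exist (fun B => B \in ball_classes X) _ cx : compact_vertex X); rewrite /= !inE eqxx.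
have [R rR] := cls r; have [N nN] := cls n; have [A aA] := cls a; have [B bB] := cls b.
have neq (C D : compact X) (x y z : X) : x \in val C -> y \in val D ->
    z \notin ball x -> z \in ball y -> C != D.
  move=> xC yD nzx zy; apply: contraNneq nzx => eqCD.
  by have := mem_ball_class y xC; rewrite {1}eqCD yD => /esym/eqP->.
have ballxx (x : X) : x \in ball x by rewrite inE eqxx.
have adj_ball (x y : X) : adj x y -> y \in ball x by rewrite inE => ->; rewrite orbT.
have nadj (C D : compact X) (x y : X) :
    x \in val C -> y \in val D -> y \notin ball x -> C != D /\ ~~ adj C D.
  move=> xC yD nxy; have neCD : C != D by apply: neq xC yD nxy _.
  by rewrite (compact_adjE xC yD neCD); split=> //; apply: contra nxy; apply: adj_ball.
have RN : adj R N by rewrite (compact_adjE rR nN) //; apply: neq rR nN ndr (adj_ball _ _ nd).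
have AB : adj A B by rewrite (compact_adjE aA bB) //; apply: neq aA bB nca (adj_ball _ _ bc).
case=> K [cliK indK].
have edge (C D : compact X) : adj C D -> (C \in K) || (D \in K).
  by apply: contraTT; rewrite negb_or => /andP[CK DK]; apply: indK; rewrite inE.
have noedge (C D : compact X) (x y : X) : x \in val C -> y \in val D -> y \notin ball x ->
    C \in K -> D \in K -> False.
  by move=> xC yD nxy CK DK; have [ne /negP[]] := nadj C D x y xC yD nxy; apply: cliK.
have [RK|NK] := orP (edge R N RN); have [AK|BK] := orP (edge A B AB).
- exact: noedge rR aA nar RK AK.
- exact: noedge rR bB nbr RK BK.
- exact: noedge nN aA nan NK AK.
exact: noedge nN bB nbn NK BK.
Qed.

Lemma solvable_graph_compact_not_split (gT : finGroupType) (G : {group gT}) r n a b c d :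
    prime r -> prime n -> prime a -> prime b -> prime c -> prime d ->
    r != n -> n != d -> a != b -> b != c -> d != r -> c != a ->
    a != r -> b != r -> a != n -> b != n ->
    joined G r n -> joined G n d -> joined G a b -> joined G b c ->
    ~ joined G r d -> ~ joined G a c -> ~ joined G r a -> ~ joined G r b ->
    ~ joined G n a -> ~ joined G n b ->
  ~ split_graph (compact (solvable_graph G)).
Proof.
move=> r_pr n_pr a_pr b_pr c_pr d_pr rn nd ab bc dr ca ar br an bn Jrn Jnd Jab Jbc.
move=> Jrd Jac Jra Jrb Jna Jnb.
have vert q s : prime q -> prime s -> joined G q s ->
    exists (u v : solvable_graph G), val u = q /\ val v = s.
  move=> q_pr s_pr [H [sHG _ dvH]]; have dvG := dvdn_trans dvH (cardSg sHG).
  have qG : q \in primes #|G| by rewrite mem_primes q_pr cardG_gt0 (dvdn_trans _ dvG) ?dvdn_mulr.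
  have sG : s \in primes #|G| by rewrite mem_primes s_pr cardG_gt0 (dvdn_trans _ dvG) ?dvdn_mull.
  by exists (SeqSub qG), (SeqSub sG).
have [vr [vn [Dr Dn]]] := vert r n r_pr n_pr Jrn.
have [va [vb [Da Db]]] := vert a b a_pr b_pr Jab.
have [_ [vc [_ Dc]]] := vert b c b_pr c_pr Jbc.
have [_ [vd [_ Dd]]] := vert n d n_pr d_pr Jnd.
have edge (u v : solvable_graph G) : val u != val v -> joined G (val u) (val v) -> adj u v.
  move=> neq [H [sHG solH dvH]]; rewrite /= /solv_adj.
  rewrite (contra_neq _ neq) => [|-> //] /=.
  by apply/existsP; exists H; rewrite sHG solH.
have noedge (u v : solvable_graph G) : val v != val u -> ~ joined G (val u) (val v) -> v \notin ball u.
  move=> neq nj; rewrite inE negb_or (contra_neq _ neq) => [|-> //] /=.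
  apply/negP=> /andP[_ /existsP[H /and3P[sHG solH dvH]]]; apply: nj.
  by exists H.
have D := (Dr, Dn, Da, Db, Dc, Dd).
by apply: (@compact_not_split _ vr vn va vb vc vd); (apply: edge || apply: noedge); rewrite !D.
Qed.

(** * Passing between a group and its central quotient *)

Lemma joined_quotient_center (gT : finGroupType) (G : {group gT}) q s :
  joined (G / 'Z(G))%g q s -> joined G q s.
Proof.
case=> H [sHG solH dvH]; have nsZG := center_normal G.
(* The preimage K is solvable because the centre is abelian, and |H| divides |K|. *)
have [K defH sZK sKG] := inv_quotientS nsZG sHG.
exists K; split=> //.
  rewrite (series_sol (normalS sZK sKG nsZG)) /= -defH solH andbT.
  exact/abelian_sol/center_abelian.
apply: dvdn_trans dvH _; rewrite defH card_quotient ?(subset_trans sKG) ?normal_norm //.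
by rewrite dvdn_indexg.
Qed.

(** The image of H has order |H| / |H :&: 'Z(G)|, and the divisor is prime to qs. *)
Lemma joined_in_quotient_center (gT : finGroupType) (G : {group gT}) q s :
    prime q -> prime s -> ~~ (q %| #|'Z(G)%g|) -> ~~ (s %| #|'Z(G)%g|) ->
  joined G q s -> joined (G / 'Z(G))%g q s.
Proof.
move=> q_pr s_pr q'Z s'Z [H [sHG solH dvH]]; exists (H / 'Z(G))%G; split.
- exact: quotientS.
- exact: quotient_sol.
have nZH : H \subset 'N('Z(G)) by rewrite (subset_trans sHG) ?normal_norm ?center_normal.
have co : coprime (q * s) #|H :&: 'Z(G)|.
  rewrite coprime_sym; apply: coprime_dvdl (cardSg (subsetIr _ _)) _.
  by rewrite coprime_sym coprimeMl !prime_coprime // q'Z.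
by rewrite /= card_quotient // -(Gauss_dvdr _ co) LagrangeI.
Qed.

(* This spares the computation of the centre of SL_n(p). *)
Lemma not_joined_ndvd_center (gT : finGroupType) (G : {group gT}) q s :
    prime q -> prime s -> q != s -> s %| #|G| -> ~ joined G q s -> ~~ (q %| #|'Z(G)%g|).
Proof.
move=> q_pr s_pr neq_qs sG nj; apply/negP=> qZ; apply: nj.
have [x Zx ox] := Cauchy q_pr qZ; have [y Gy oy] := Cauchy s_pr sG.
have [Gx cGx] := setIP Zx.
apply: (joined_semidirect q_pr s_pr neq_qs Gx Gy ox oy).
apply: (subsetP (cent_sub _)); rewrite cent_cycle; apply/cent1P.
by apply/commute_sym/(centP cGx).
Qed.

(** * Non-edges in SL_n(p), read off from the orders of p *)

Section Primes.
Variables (p m : nat).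
Local Notation n := m.+1.
Hypotheses (n_pr : prime n) (p_pr : prime p) (n_gt13 : 13 < n) (ordn : has_order n p m).
Local Notation joinedSL := (joined (SL n p)).

Let p_gt0 : 0 < p. Proof. exact: prime_gt0. Qed.

Definition prime_of_order f q := prime q /\ has_order q p f.

Lemma prime_of_order_neq f g q s : prime_of_order f q -> prime_of_order g s -> f != g -> q != s.
Proof.
move=> [_ ordq] [_ ords]; apply: contraNneq => eq_qs; rewrite eq_qs in ordq.
by rewrite (has_order_uniq ordq ords).
Qed.

Lemma prime_of_order_ndvd_pred f q : prime_of_order f q -> 1 < f -> ~~ (q %| p.-1).
Proof.
case=> _ ordq f_gt1; rewrite -subn1 -{1}(expn1 p) ordq dvdn1.
by rewrite neq_ltn f_gt1 orbT.
Qed.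

Lemma not_joinedSL f g q s : prime_of_order f q -> prime_of_order g s -> f != g ->
    0 < f -> 0 < g -> rigid n f s -> rigid n g q -> n < f + g -> n < lcmn f g ->
  ~ joinedSL q s.
Proof.
move=> oq os ne f_gt0 g_gt0 rf rg lt_fg lt_l; have [q_pr ordq] := oq; have [s_pr ords] := os.
have neq_p t h : prime_of_order h t -> 0 < h -> t != p.
  case=> t_pr ordt h_gt0; apply: contraNneq (has_order_ndvd t_pr p_gt0 h_gt0 ordt) => ->.
  exact: dvdnn.
case=> H [_ solH dvH].
apply: (not_joined p_pr q_pr s_pr (neq_p _ _ oq f_gt0) (neq_p _ _ os g_gt0)
  (prime_of_order_neq oq os ne) ordq ords rf rg lt_fg lt_l).
by exists H; rewrite subsetT.
Qed.

(** For r-groups rigidity holds as n < 2n and s does not divide n; for s-groups, as r > n and g does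
    not divide n. *)
Lemma singer_not_joined r g s : prime_of_order n r -> prime_of_order g s ->
  s != n -> 1 < g < n -> ~ joinedSL r s.
Proof.
move=> o_r os neq_sn /andP[g_gt1 lt_gn]; have [r_pr ordr] := o_r; have [s_pr ords] := os.
have g'n : ~~ (g %| n).
  apply/negP=> gn; have /primeP[_ /(_ g gn)/orP[]/eqP eg] := n_pr.
    by rewrite eg in g_gt1.
  by rewrite eg ltnn in lt_gn.
have n_r : n < r := dvdn_pred_prime_ltn r_pr (has_order_dvd_pred r_pr p_gt0 (ltn0Sn m) ordr).
apply: (not_joinedSL o_r os); rewrite ?(ltnW g_gt1) //.
- by rewrite neq_ltn lt_gn orbT.
- by rewrite /rigid ltn_Pmull // dvdn_prime2 // neq_sn.
- by rewrite /rigid (ltnW n_r) g'n orbT.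
- by rewrite -[X in X < _]addn0 ltn_add2l ltnW.
by apply: ltn_lcmn; rewrite ?(ltnW g_gt1).
Qed.

(* As p has order n - 1 modulo n, the prime n is itself of this kind. *)
Lemma dim_not_joined g s : prime_of_order g s -> ~~ (s %| m) -> ~~ (g %| m) -> 1 < g < n ->
  ~ joinedSL n s.
Proof.
move=> os s'm g'm /andP[g_gt1 lt_gn]; have [s_pr ords] := os.
have g_gt0 : 0 < g := ltnW g_gt1.
have m_gt1 : 1 < m by move: n_gt13; clear; lia.
have g'n : ~~ (g %| n).
  apply/negP=> gn; have /primeP[_ /(_ g gn)/orP[]/eqP eg] := n_pr.
    by rewrite eg in g_gt1.
  by rewrite eg ltnn in lt_gn.
have on : prime_of_order m n by split.
have lt_n2m : n < 2 * m by move: n_gt13; clear; lia.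
apply: (not_joinedSL on os); rewrite ?(ltnW m_gt1) //.
- by apply: contraNneq g'm => ->.
(* The two directions use different alternatives of [rigid]; in the second, the acting element has
   order n. *)
- by rewrite /rigid lt_n2m s'm.
- by rewrite /rigid leqnn g'n orbT.
- by rewrite -addn1 ltn_add2l.
by apply: leq_trans lt_n2m _; apply: leq_double_lcmn; rewrite // ltnW.
Qed.

(** Oddness gives q > 2f > g and s > 2g > f, so both directions are rigid. As f < g < 2f, f does not
    divide g, and the lcm is at least 2g > n. *)
Lemma large_not_joined f g q s : prime_of_order f q -> prime_of_order g s ->
    odd f -> odd g -> n < 2 * f -> f < g -> g < n ->
  ~ joinedSL q s.
Proof.
move=> oq os odd_f odd_g lt_n2f lt_fg lt_gn; have [q_pr ordq] := oq; have [s_pr ords] := os.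
have f_gt1 : 1 < f by move: n_gt13 lt_n2f; clear; lia.
have g_gt1 := ltn_trans f_gt1 lt_fg.
have [_ ltq] := has_order_pred_odd q_pr p_gt0 f_gt1 odd_f ordq.
have [_ lts] := has_order_pred_odd s_pr p_gt0 g_gt1 odd_g ords.
have lt_n2g : n < 2 * g by move: lt_n2f lt_fg; clear; lia.
apply: (not_joinedSL oq os); rewrite ?(ltnW f_gt1) ?(ltnW g_gt1) //.
- by rewrite neq_ltn lt_fg.
- by rewrite /rigid lt_n2f gtnNdvd ?(ltnW f_gt1) //; move: lts lt_fg; clear; lia.
- by rewrite /rigid lt_n2g gtnNdvd ?(ltnW g_gt1) //; move: ltq lt_n2f lt_gn; clear; lia.
- by move: lt_n2f lt_fg; clear; lia.
apply: leq_trans lt_n2g _; rewrite lcmnC; apply: leq_double_lcmn; rewrite ?(ltnW f_gt1) ?(ltnW g_gt1) //.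
apply/negP=> /dvdnP[w]; move: lt_fg lt_n2f lt_gn; case: w => [|[|w]]; clear; nia.
Qed.

End Primes.

End Graph.

(** * Assembly of the 2K_2 for PSL_n(p) *)

Theorem proposition7p4 (n p : nat) (n_prime : prime n) (p_prime : prime p)
    (n_gt13 : (13 < n)%N) (p_root : primitive_root_mod n p) :
  ~ split_graph (compact (solvable_graph (PSL n p))).
Proof.
case: n => // m in n_prime n_gt13 p_root *.
have p_gt1 := prime_gt1 p_prime.
have ordn : has_order m.+1 p m := primitive_root_has_order n_prime p_root.
have odd_n : odd m.+1.
  by case: (even_prime n_prime) n_gt13 => // ->.
have even_m : ~~ odd m by [].
(* n > 13 gives m >= 13, and m is even. *)
have m_gt13 : 13 < m by move: n_gt13 even_m; rewrite ltnS leq_eqVlt => /orP[/eqP<-|].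
have m_gt1 : 1 < m by apply: ltn_trans m_gt13.
have m_gt0 := ltnW m_gt1.
have [r r_pr ordr] := zsigmondy_odd p_gt1 odd_n (prime_gt1 n_prime).
have [i [j [k [[odd_i odd_j odd_k] [lt_n2i lt_ik le_jk lt_m4j ne2j]]]]] :=
  order_choice odd_n n_gt13 n_prime.
have i_gt1 : 1 < i by move: lt_n2i m_gt1; clear; lia.
have j_gt1 : 1 < j by move: lt_m4j m_gt13; clear; lia.
have k_gt1 : 1 < k by apply: ltn_trans lt_ik.
have lt_kn : k < m.+1 by move: le_jk j_gt1; clear; lia.
have lt_in := ltn_trans lt_ik lt_kn.
have lt_jn : j < m.+1 by move: le_jk k_gt1; clear; lia.
have lt_ji : j < i by move: le_jk lt_ik lt_n2i; clear; lia.
have lt_m4i : m < 4 * i by move: lt_n2i; clear; lia.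
have ne2i : (2 * i)%N != m by move: lt_n2i; clear; lia.
have even_ne f : odd f -> f != m by apply: contraTneq => ->.
have [a a_pr orda] := zsigmondy_odd p_gt1 odd_i i_gt1.
have [b b_pr ordb] := zsigmondy_odd p_gt1 odd_j j_gt1.
have [c c_pr ordc] := zsigmondy_odd p_gt1 odd_k k_gt1.
have [t [t_gt1 tm ne_tm t_odd4]] := odd_divisor_or_four m_gt13 even_m.
have [d d_pr ordd] : exists2 d, prime d & has_order d p t.
  case: t_odd4 => [odd_t|->]; first exact: zsigmondy_odd.
  exact: has_order4_exists.
have lt_tn : t < m.+1 by rewrite ltnS dvdn_leq.
have o_n : prime_of_order p m m.+1 by split.
have o_r : prime_of_order p m.+1 r by split.
have oa : prime_of_order p i a by split.
have ob : prime_of_order p j b by split.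
have oc : prime_of_order p k c by split.
have od : prime_of_order p t d by split.
have [odd_a lt_a] := has_order_pred_odd a_pr (ltnW p_gt1) i_gt1 odd_i orda.
have [odd_b lt_b] := has_order_pred_odd b_pr (ltnW p_gt1) j_gt1 odd_j ordb.
(* a > 2i gives 2a > 4i > m, too large for an odd divisor of the even m. *)
have a'm : ~~ (a %| m) by apply: odd_ndvd_even_half => //; move: lt_m4i lt_a; clear; lia.
have b'm : ~~ (b %| m) by apply: odd_ndvd_even_half => //; move: lt_m4j lt_b; clear; lia.
have i'm : ~~ (i %| m) by apply: odd_ndvd_even_quarter.
have j'm : ~~ (j %| m) by apply: odd_ndvd_even_quarter.
have pred := prime_of_order_ndvd_pred.
have neq := prime_of_order_neq.
have ne_nm : m != m.+1 by rewrite neq_ltn ltnSn.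
have ne_lt f : f < m.+1 -> f != m.+1 by move=> lt; rewrite neq_ltn lt.
have an : a != m.+1 by apply: neq oa o_n (even_ne i odd_i).
have bn : b != m.+1 by apply: neq ob o_n (even_ne j odd_j).
have dn : d != m.+1 by apply: neq od o_n ne_tm.
have rn : r != m.+1 by rewrite eq_sym; apply: neq o_n o_r ne_nm.
have ar : a != r by apply: neq oa o_r (ne_lt i lt_in).
have br : b != r by apply: neq ob o_r (ne_lt j lt_jn).
have dr : d != r by apply: neq od o_r (ne_lt t lt_tn).
have ab : a != b by rewrite eq_sym; apply: neq ob oa _; rewrite neq_ltn lt_ji.
have bc : b != c by apply: neq ob oc _; rewrite neq_ltn (ltn_trans lt_ji).
have ac : a != c by apply: neq oa oc _; rewrite neq_ltn lt_ik.
pose S := SL_group m.+1 p.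
have Jrn : joined S r m.+1.
  apply: joined_frobenius => //; first exact: pred o_r _.
    exact: pred o_n _.
  by rewrite ordr.
(* Both n and d divide p^(n-1) - 1, so a block of size n - 1 carries commuting elements of both
   orders. *)
have Jnd : joined S m.+1 d.
  apply: (@joined_singer p m p_prime m) => //; rewrite 1?eq_sym ?m_gt0 ?leqnSn ?ordn ?ordd //.
    exact: pred o_n _.
  exact: pred od _.
have Jab : joined S a b.
  apply: (joined_blocks p_prime a_pr b_pr ab (pred _ _ _ oa i_gt1) (pred _ _ _ ob j_gt1)
    (ltnW i_gt1) (ltnW j_gt1) orda ordb).
  by move: le_jk lt_ik; clear; lia.
have Jbc : joined S b c.
  exact: (joined_blocks p_prime b_pr c_pr bc (pred _ _ _ ob j_gt1) (pred _ _ _ oc k_gt1)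
    (ltnW j_gt1) (ltnW k_gt1) ordb ordc).
have Nrd : ~ joined S r d by apply: (singer_not_joined n_prime p_prime o_r od dn); rewrite t_gt1.
have Nra : ~ joined S r a by apply: (singer_not_joined n_prime p_prime o_r oa an); rewrite i_gt1.
have Nrb : ~ joined S r b by apply: (singer_not_joined n_prime p_prime o_r ob bn); rewrite j_gt1.
have Nna : ~ joined S m.+1 a by apply: (dim_not_joined n_prime p_prime n_gt13 ordn oa a'm i'm); rewrite i_gt1.
have Nnb : ~ joined S m.+1 b by apply: (dim_not_joined n_prime p_prime n_gt13 ordn ob b'm j'm); rewrite j_gt1.
have Nac : ~ joined S a c by apply: (large_not_joined p_prime n_gt13 oa oc).
have dvS q s : joined S q s -> (q %| #|S|) /\ (s %| #|S|).
  case=> H [sHS _ dvH]; have dv := dvdn_trans dvH (cardSg sHS).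
  by split; apply: dvdn_trans dv; [apply: dvdn_mulr | apply: dvdn_mull].
have [rS nS] := dvS _ _ Jrn; have [aS _] := dvS _ _ Jab.
have Z q s : prime q -> prime s -> q != s -> s %| #|S| -> ~ joined S q s -> ~~ (q %| #|'Z(S)%g|).
  exact: not_joined_ndvd_center.
(* Each of the six primes has a non-neighbour dividing |S|, so none divides the order of the centre
   and the edges survive in the quotient. *)
have rZ : ~~ (r %| #|'Z(S)%g|) by apply: (Z r a); rewrite // eq_sym.
have nZ : ~~ (m.+1 %| #|'Z(S)%g|) by apply: (Z m.+1 a); rewrite // eq_sym.
have aZ : ~~ (a %| #|'Z(S)%g|) by apply: (Z a r) => // /joinedC.
have bZ : ~~ (b %| #|'Z(S)%g|) by apply: (Z b r) => // /joinedC.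
have cZ : ~~ (c %| #|'Z(S)%g|) by apply: (Z c a) => //; rewrite 1?eq_sym // => /joinedC.
have dZ : ~~ (d %| #|'Z(S)%g|) by apply: (Z d r) => // /joinedC.
have Q q s : ~ joined S q s -> ~ joined (PSL m.+1 p) q s.
  by move=> nj /(@joined_quotient_center _ S).
apply: (@solvable_graph_compact_not_split _ _ r m.+1 a b c d) => //; rewrite 1?eq_sym //;
  try exact: Q; exact: (@joined_in_quotient_center _ S).
Qed.
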